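(* Let $\rho$ be a Lévy density on $(0,\infty)$ satisfying the standing assumptions described in the context, and let $f$ be the density of $T$. For every $t>0$, every $k\ge 1$ and all positive integers $n_1,\dots,n_k$ with $n=\sum_{i=1}^k n_i$, the EPPF of a $\mathrm{PK}(\rho\,|\,t)$-partition is $$p(n_1,\dots,n_k\,|\,t)=t^{k-1}\int_0^1 p^{\,n+k-2}\, I(n_1,\dots,n_k;tp)\,\tilde f(p\,|\,t)\,dp,$$ where $I(n;v)=1$ if $k=1$ (and $n_1=n$), and for $k=2,3,\dots$ $$I(n_1,\dots,n_k;v):=\frac{1}{\rho(v)}\int_{\mathcal S_k}\Big[\prod_{i=1}^k\rho(vu_i)\,u_i^{n_i}\Big]du_1\cdots du_{k-1},$$ with $\mathcal S_k=\{(u_1,\dots,u_k):u_i\ge 0,\ u_1+\cdots+u_k=1\}$.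
   Context: Standing setup (Poisson–Kingman model). $\rho$ is a measurable function on $(0,\infty)$ (a Lévy density) with $\int_0^1 x\rho(x)dx<\infty$ and $\int_1^\infty\rho(x)dx<\infty$. Let $J_1\ge J_2\ge\cdots$ be the ranked points of a Poisson point process on $(0,\infty)$ with intensity $\rho(x)dx$, and $T=\sum_i J_i$. Regularity assumption: the law of $T$ has a density $f$ that is strictly positive and continuous on $(0,\infty)$ (so $\int_0^\infty\rho=\infty$). For $t>0$ and $0<p<1$ put $\tilde f(p\,|\,t):=pt\,\rho(pt)\,f((1-p)t)/f(t)$; for each $t>0$ this is a probability density in $p$ on $(0,1)$. The distribution $\mathrm{PK}(\rho\,|\,t)$ (the conditional law of $(J_i/T)$ given $T=t$) is the law of the decreasing rearrangement of $(\tilde P_j)_{j\ge1}$ constructed as follows: $T_0=t$; given $T_0,\dots,T_j$, the variable $G_{j+1}$ has density $\tilde f(\cdot\,|\,T_j)$ on $(0,1)$; $\tilde P_{j+1}=G_{j+1}T_j/t$ and $T_{j+1}=T_j(1-G_{j+1})$. An exchangeable random partition $\Pi$ of $\mathbb N=\{1,2,\dots\}$ is generated by sampling from a random probability sequence $(P_i)$: conditionally on $(P_i)$, i.i.d. labels $X_1,X_2,\dots$ with $\Pr(X_m=i)=P_i$, and $m,m'$ in the same block iff $X_m=X_{m'}$. Its EPPF is the symmetric function $p$ with $\Pr(\Pi_n=\{A_1,\dots,A_k\})=p(\#A_1,\dots,\#A_k)$ for every partition $\{A_1,\dots,A_k\}$ of $\{1,\dots,n\}$, where $\Pi_n$ is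 the restriction of $\Pi$ to $\{1,\dots,n\}$. A $\mathrm{PK}(\rho\,|\,t)$-partition is an exchangeable partition generated by sampling from a sequence with law $\mathrm{PK}(\rho\,|\,t)$.
   Formalization: Since ρ may vanish, making 1/ρ(tp) undefined, the integrand I(n_1,…,n_k;tp) f̃(p|t) is taken with 1/ρ(tp) cancelled against ρ(pt); the partition is sampled from (P̃_j) itself rather than from its decreasing rearrangement, which gives the same law. *)

(* Defs.v *)
From HB Require Import structures.
From mathcomp Require Import all_boot all_order all_algebra.
From mathcomp Require Import all_classical all_reals all_analysis.
Set Implicit Arguments. Unset Strict Implicit. Unset Printing Implicit Defensive.
Import Order.TTheory GRing.Theory Num.Theory.
Import numFieldNormedType.Exports.
Local Open Scope classical_set_scope.
Local Open Scope ring_scope.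

Definition posR {R : realType} : set R := `]0, +oo[.
Definition gt1R {R : realType} : set R := `]1, +oo[.
Definition I01R {R : realType} : set R := `]0, 1[.
Definition Ioc01R {R : realType} : set R := `]0, 1].

Local Open Scope ereal_scope.

Section PK.
Context {R : realType}.
Local Notation mu := (@lebesgue_measure R).

(* Poisson(m) probability mass function (correct also for m = 0). *)
Definition pois (m : R) (j : nat) : R := (expR (- m) * m ^+ j / j`!%:R)%R.

Definition intensity (rho : R -> R) (B : set R) : \bar R :=
  \int[mu]_(x in B) (rho x)%:E.

Definition count_in {d} {Omega : measurableType d} (J : nat -> Omega -> R)
  (B : set R) (w : Omega) : \bar R :=
  \esum_(i in [set i | B (J i w)]) 1.

(* J_1 >= J_2 >= ... (indexed from 0) are the ranked points of a Poisson
   point process on (0,oo) with intensity rho(x)dx: they are measurable,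
   positive, non-increasing, and for pairwise disjoint Borel sets
   B_1..B_m in (0,oo) of finite intensity the counts N(B_j) are independent
   Poisson(int_{B_j} rho) variables. *)
Definition ranked_PPP {d} {Omega : measurableType d}
  (P : probability Omega R) (rho : R -> R) (J : nat -> Omega -> R) : Prop :=
  [/\ (forall i, measurable_fun setT (J i)),
      (forall i w, (0 < J i w)%R),
      (forall i w, (J i.+1 w <= J i w)%R) &
      (forall (m : nat) (B : 'I_m -> set R) (c : 'I_m -> nat),
          (forall j, measurable (B j)) ->
          (forall j, B j `<=` posR) ->
          (forall j j', j != j' -> B j `&` B j' = set0) ->
          (forall j, intensity rho (B j) < +oo) ->
          P (\bigcap_(j in [set: 'I_m]) [set w | count_in J (B j) w = (c j)%:R%:E])
          = (\prod_(j < m) pois (fine (intensity rho (B j))) (c j))%:E)].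

Definition sumJ {d} {Omega : measurableType d} (J : nat -> Omega -> R)
  (w : Omega) : \bar R := \sum_(0 <= i <oo) (J i w)%:E.

Definition has_density {d} {Omega : measurableType d}
  (P : probability Omega R) (X : Omega -> \bar R) (f : R -> R) : Prop :=
  forall A : set R, measurable A ->
    P [set w | exists x, X w = x%:E /\ A x] = \int[mu]_(x in A `&` posR) (f x)%:E.

Definition ftilde (rho f : R -> R) (p t : R) : R :=
  (p * t * rho (p * t) * f ((1 - p) * t) / f t)%R.

(* Finite-dimensional laws of the sequential construction:
   PKiter m B s = Pr(G_1 in B 0, ..., G_m in B (m-1)) when T_0 = s,
   where G_{j+1} has density ftilde(. | T_j) on (0,1) and T_{j+1} = T_j(1-G_{j+1}). *)
Fixpoint PKiter (rho f : R -> R) (m : nat) (B : nat -> set R) (s : R) : \bar R :=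
  match m with
  | 0 => 1
  | m'.+1 => \int[mu]_(g in B 0%N `&` I01R)
              ((ftilde rho f g s)%:E * PKiter rho f m' (fun j => B j.+1) (s * (1 - g))%R)
  end.

(* G (indexed from 0: G 0 = G_1, ...) realises the sequential construction
   of PK(rho | t). *)
Definition PK_construction {d} {Omega : measurableType d}
  (P : probability Omega R) (rho f : R -> R) (t : R) (G : nat -> Omega -> R) : Prop :=
  (forall j, measurable_fun setT (G j)) /\
  (forall (m : nat) (B : nat -> set R), (forall j, measurable (B j)) ->
     P (\bigcap_(j in [set j | (j < m)%N]) [set w | B j (G j w)]) = PKiter rho f m B t).

(* \tilde P_{j+1} = G_{j+1} T_j / t = G_{j+1} prod_{i<=j} (1 - G_i) *)
Definition Ptilde {d} {Omega : measurableType d} (G : nat -> Omega -> R)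
  (j : nat) (w : Omega) : R := (G j w * \prod_(i < j) (1 - G i w))%R.

Definition induces (n : nat) (pi : {set {set 'I_n}}) (x : {ffun 'I_n -> nat}) : Prop :=
  forall m m' : 'I_n, (x m == x m') = (finset.pblock pi m == finset.pblock pi m').

(* Pr(Pi_n = pi) for the partition generated by sampling i.i.d. labels
   X_1..X_n with Pr(X_m = i | P) = P_i, P = Ptilde(w):
   E[ sum over labellings inducing pi of prod_m P_{x_m} ]. *)
Definition sampling_partition_prob {d} {Omega : measurableType d}
  (P : probability Omega R) (Pseq : nat -> Omega -> R) (n : nat)
  (pi : {set {set 'I_n}}) : \bar R :=
  \int[P]_(w in setT)
     (\esum_(x in [set x | induces pi x]) (\prod_(m < n) Pseq (x m) w)%:E).

(* simplex integral, iterated: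
   Jsimp v [:: n_1; ...; n_k] s =
     int_{u_1+..+u_k = s, u_i >= 0} prod_i rho(v u_i) u_i^{n_i} du_1..du_{k-1}. *)
Fixpoint Jsimp (rho : R -> R) (v : R) (ns : seq nat) (s : R) : \bar R :=
  match ns with
  | [::] => 0
  | m :: ns' =>
      match ns' with
      | [::] => (rho (v * s) * s ^+ m)%:E
      | _ :: _ => \int[mu]_(u in `[0%R, s]) ((rho (v * u) * u ^+ m)%:E
                                           * Jsimp rho v ns' (s - u)%R)
      end
  end.

(* the integrand I(n_1..n_k; t p) * ftilde(p | t), with the factor
   1/rho(tp) of I cancelled against rho(pt) in ftilde(p | t)
   (for k = 1, Jsimp v [:: n] 1 = rho v, so this is 1 * ftilde(p|t)). *)
Definition I_ftilde (rho f : R -> R) (ns : seq nat) (t p : R) : \bar R :=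
  Jsimp rho (t * p) ns 1 * (p * t * f ((1 - p) * t) / f t)%:E.

End PK.

(* Main.v *)
Require Import Defs.
From HB Require Import structures.
From mathcomp Require Import all_boot all_order all_algebra.
From mathcomp Require Import all_classical all_reals all_analysis.
From mathcomp Require Import finmap zify ring lra.
Import Order.TTheory GRing.Theory Num.Theory.
Import numFieldNormedType.Exports.
Import measurable_realfun HBNNSimple.
Local Open Scope classical_set_scope.
Local Open Scope ring_scope.
Local Open Scope ereal_scope.
Set Implicit Arguments.
Unset Strict Implicit.

(** Rescale so that t = 1, write r for the rescaled Lévy density and F for the
    rescaled density of T.  Expectations of products phi_1(G_1)...phi_m(G_m), times
    F(1), are iterates at 1 of the operators
      (L_phi Psi)(s) = int_0^1 phi(g) (g s) r(g s) Psi(s (1 - g)) dg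
    applied to F.  Let W_l be the convolution of the functions v^{n_i} r(v) and F,
    divided by s^n; up to F(1), its value at 1 is the right-hand side of the theorem.
    Splitting 1 = g + (1 - g) and exchanging the order of two integrations shows that
    W_l satisfies the first-step recursion of the occupancy problem: the first stick
    is used by none of the blocks, or by exactly one of them.  The probabilities that
    all blocks use labels below M satisfy the same recursion started from l = [], and
    the difference is at most the number of blocks times the expectation of
    (1 - G_1)...(1 - G_M).  This tends to 0, since by compactness G is bounded
    below in mean as long as the remaining mass stays away from 0. *)

(** * Nonnegative measurable functions *)

Section nonnegative_measurable.
Context {R : realType}.

(** The normalisation of [ftilde(. | s)], that is L_1 F = F, is read off from the law of G, and G
    starts from the single mass t. So it is obtained in a weak form only: at the point 1, after an
    arbitrary composition of stick operators. This is why the recursions below carry a list [phis]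
    in front, are evaluated at 1, and are proved by inductions that generalise over [phis]. The
    first-step recursion alone does not identify its solution. Both families are therefore iterated
    M times, and by linearity they differ only through the initial data on nonempty lists, which is
    where the bound on the remaining mass enters. Block sizes are stored minus one because h(x) = x
    r(x) already holds one factor x, so that x^(n-1) h(x) = x^n r(x). All functions are nonnegative
    with extended real values, so Tonelli and monotone convergence apply without integrability
    conditions. *)

Definition nnm {d} {T : measurableType d} (f : T -> \bar R) : Prop :=
  measurable_fun setT f /\ forall x, 0 <= f x.

Lemma nnm_cst {d} {T : measurableType d} (c : \bar R) :
  0 <= c -> nnm (fun _ : T => c).
Proof. by move=> c0; split. Qed.

Lemma nnmD {d} {T : measurableType d} (f g : T -> \bar R) :
  nnm f -> nnm g -> nnm (fun x => f x + g x).
Proof.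
move=> [mf f0] [mg g0]; split; first exact: emeasurable_funD.
by move=> x; rewrite adde_ge0.
Qed.

Lemma nnmM {d} {T : measurableType d} (f g : T -> \bar R) :
  nnm f -> nnm g -> nnm (fun x => f x * g x).
Proof.
move=> [mf f0] [mg g0]; split; first exact: emeasurable_funM.
by move=> x; rewrite mule_ge0.
Qed.

Lemma nnm_comp {d d'} {T : measurableType d} {T' : measurableType d'}
  (f : T' -> \bar R) (g : T -> T') :
  nnm f -> measurable_fun setT g -> nnm (fun x => f (g x)).
Proof.
move=> [mf f0] mg; split; last by move=> x.
by apply: (measurableT_comp mf mg).
Qed.

Lemma nnm_EFin {d} {T : measurableType d} (f : T -> R) :
  measurable_fun setT f -> (forall x, (0 <= f x)%R) -> nnm (fun x => (f x)%:E).
Proof.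
by move=> mf f0; split => [|x]; [exact/measurable_EFinP | rewrite lee_fin].
Qed.

Lemma nnm_sum {d} {T : measurableType d} (I : Type) (s : seq I)
  (f : I -> T -> \bar R) :
  (forall i, nnm (f i)) -> nnm (fun x => \sum_(i <- s) f i x).
Proof.
move=> mf; split.
  by apply: emeasurable_sum => i; case: (mf i).
by move=> x; apply: sume_ge0 => i _; case: (mf i).
Qed.

Lemma nnm_indic {d} {T : measurableType d} (A : set T) :
  measurable A -> nnm (fun x => (\1_A x : R)%:E).
Proof. by move=> mA; apply: nnm_EFin. Qed.

(** The standard machine: a simple function is a finite combination of indicators of its level sets,
    and simple functions increase to f. *)
Lemma nnm_ind {d} {T : measurableType d} (Pr : (T -> \bar R) -> Prop) :
  (forall A, measurable A -> Pr (fun x => (\1_A x : R)%:E)) ->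
  (forall (c : R) f, (0 <= c)%R -> nnm f -> Pr f -> Pr (fun x => c%:E * f x)) ->
  (forall f g, nnm f -> nnm g -> Pr f -> Pr g -> Pr (fun x => f x + g x)) ->
  (forall f : (T -> \bar R)^nat, (forall n, nnm (f n)) ->
     (forall x, {homo f^~ x : n m / (n <= m)%N >-> n <= m}) ->
     (forall n, Pr (f n)) -> Pr (fun x => limn (f^~ x))) ->
  forall f, nnm f -> Pr f.
Proof.
move=> Pind PZ PD Plim f [mf f0].
pose g := nnsfun_approx measurableT mf.
have -> : f = fun x => limn (fun n => (g n x)%:E).
  apply/funext => x; apply/esym/cvg_lim => //.
  by apply: cvg_nnsfun_approx.
have nnmg (k : {nnsfun T >-> R}) : nnm (fun x => (k x)%:E).
  apply: nnm_EFin => //.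
apply: (Plim (fun n x => (g n x)%:E)) => //.
  by move=> x n m nm; rewrite lee_fin; exact/lefP/nd_nnsfun_approx.
move=> n; move: (g n) => k.
have mk y : measurable (k @^-1` [set y]).
  exact: measurable_sfunP.
have -> : (fun x => (k x)%:E) =
    fun x => \sum_(y <- fset_set (range k)) y%:E * (\1_(k @^-1` [set y]) x)%:E.
  apply/funext => x; rewrite fimfunE fsbig_finite//= -sumEFin.
  by apply: eq_bigr => y _; rewrite EFinM.
have : forall y, y \in (fset_set (range k) : seq R) -> (0 <= y)%R.
  by move=> y yk; have := yk : y \in fset_set (range k); rewrite in_fset_set// => /set_mem[x _ <-].
elim: (fset_set (range k) : seq R) => [_|y s IHs s0].
  (* The zero function is reached as the indicator of the empty set. *)
  have -> : (fun x => \sum_(y <- [::]) y%:E * (\1_(k @^-1` [set y]) x)%:E) =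
      (fun x => (\1_(set0 : set T) x : R)%:E).
    by apply/funext => x; rewrite big_nil indic0.
  exact: Pind.
have s0' z : z \in s -> (0 <= z)%R by move=> zs; apply: s0; rewrite in_cons zs orbT.
under eq_fun do rewrite big_cons.
have y0 : (0 <= y)%R by apply: s0; rewrite in_cons eqxx.
apply: PD.
- by apply: nnmM; [exact: nnm_cst | exact: nnm_indic].
- split.
    apply: emeasurable_sum => z.
    by apply: emeasurable_funM => //; exact/measurable_EFinP.
  move=> x; rewrite big_seq; apply: sume_ge0 => z zs.
  by rewrite mule_ge0// lee_fin// s0'.
- by apply: PZ => //; [exact: nnm_indic | exact: Pind].
- exact: IHs.
Qed.

Lemma integral_nnmD {d} {T : measurableType d} (m : {measure set T -> \bar R})
  (f g : T -> \bar R) : nnm f -> nnm g ->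
  \int[m]_x (f x + g x) = \int[m]_x f x + \int[m]_x g x.
Proof. by move=> [mf f0] [mg g0]; rewrite ge0_integralD. Qed.

Lemma integral_nnmZ {d} {T : measurableType d} (m : {measure set T -> \bar R})
  (c : \bar R) (f : T -> \bar R) : 0 <= c -> nnm f ->
  \int[m]_x (c * f x) = c * \int[m]_x f x.
Proof. by move=> c0 [mf f0]; rewrite ge0_integralZl. Qed.

Lemma integral_nnm_sum {d} {T : measurableType d} (m : {measure set T -> \bar R})
  (I : Type) (s : seq I) (f : I -> T -> \bar R) : (forall i, nnm (f i)) ->
  \int[m]_x (\sum_(i <- s) f i x) = \sum_(i <- s) \int[m]_x f i x.
Proof.
move=> mf; rewrite ge0_integral_sum//.
  by move=> i; case: (mf i).
by move=> i x _; case: (mf i).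
Qed.

Lemma le_integral_nnm {d} {T : measurableType d} (m : {measure set T -> \bar R})
  (f g : T -> \bar R) : nnm f -> nnm g -> (forall x, f x <= g x) ->
  \int[m]_x f x <= \int[m]_x g x.
Proof. by move=> [mf f0] [mg g0] fg; apply: ge0_le_integral. Qed.

Lemma integral_nnm_ge0 {d} {T : measurableType d} (m : {measure set T -> \bar R})
  (f : T -> \bar R) : nnm f -> 0 <= \int[m]_x f x.
Proof. by move=> [_ f0]; apply: integral_ge0. Qed.

Lemma integral_nnm_lim {d} {T : measurableType d}
  (m : {measure set T -> \bar R}) (f : (T -> \bar R)^nat) :
  (forall n, nnm (f n)) ->
  (forall x, {homo f^~ x : n m / (n <= m)%N >-> n <= m}) ->
  \int[m]_x limn (f^~ x) = limn (fun n => \int[m]_x f n x).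
Proof.
move=> mf ndf; apply: monotone_convergence => //.
- by move=> n; case: (mf n).
- by move=> n x _; case: (mf n).
Qed.

(** Here c may be infinite, where multiplication is not continuous. Monotonicity turns limits into
    suprema; for c = +oo both sides are +oo if some [u n] is positive and 0 otherwise. *)
Lemma limn_nnmZ (c : \bar R) (u : (\bar R)^nat) : 0 <= c ->
  (forall n, 0 <= u n) -> {homo u : n m / (n <= m)%N >-> n <= m} ->
  limn (fun n => c * u n) = c * limn u.
Proof.
move=> c0 u0 ndu.
have [->|cn0] := eqVneq c 0.
  by rewrite mul0e; under eq_fun do rewrite mul0e; exact: lim_cst.
have ndcu : {homo (fun n => c * u n) : n m / (n <= m)%N >-> n <= m}.
  by move=> n m nm; rewrite lee_wpmul2l ?ndu.
have cu := ereal_nondecreasing_cvgn ndu.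
have ccu := ereal_nondecreasing_cvgn ndcu.
rewrite (cvg_lim _ cu)// (cvg_lim _ ccu)//.
have -> : range (fun n => c * u n) = [set c * x | x in range u].
  apply/seteqP; split => [_ [n _ <-]|_ [_ [n _ <-] <-]]; last by exists n.
  by exists (u n) => //; exists n.
move: c0 cn0; case: c {ndcu ccu} => [r| |] //; last first.
  move=> _ _; have [[n un]|noun] := pselect (exists n, 0 < u n).
    rewrite gt0_mulye; last by apply: lt_le_trans un _; apply: ereal_sup_ubound; exists n.
    apply/eqP; rewrite eq_le leey/=; apply: ereal_sup_ubound.
    by exists (u n); [exists n | rewrite gt0_mulye].
  have un0 n : u n = 0.
    apply/eqP; rewrite eq_le u0 andbT leNgt; apply/negP => ?; apply: noun.
    by exists n.
  have -> : range u = [set 0].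
    by apply/seteqP; split => [_ [n _ <-]|_ ->]; [rewrite un0 | exists 0%N].
  by rewrite image_set1 !ereal_sup1.
move=> r0 rn0; rewrite -(cvg_lim _ cu)// -limeMl//; last first.
  by apply/cvg_ex; eexists; exact: cu.
have ndcu : {homo (fun n => r%:E * u n) : n m / (n <= m)%N >-> n <= m}.
  by move=> n m nm; rewrite lee_wpmul2l ?ndu.
have ccu := ereal_nondecreasing_cvgn ndcu.
rewrite (cvg_lim _ ccu)//; congr ereal_sup.
apply/seteqP; split => [_ [_ [n _ <-] <-]|_ [n _ <-]]; first by exists n.
by exists (u n) => //; exists n.
Qed.

Lemma nnm_fubini {d d'} {T : measurableType d} {T' : measurableType d'}
  (m : {sigma_finite_measure set T' -> \bar R}) (f : T * T' -> \bar R) :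
  nnm f -> nnm (fun x => \int[m]_y f (x, y)).
Proof.
move=> [mf f0]; split; last by move=> x; exact: integral_ge0.
exact: (measurable_fun_fubini_tonelli_F f mf f0).
Qed.

End nonnegative_measurable.

(** * Change of variables and convolution *)

Section affine_change_of_variables.
Context {R : realType}.
Local Notation mu := (@lebesgue_measure R).

(** Both measures agree on half-open intervals, which determine Lebesgue measure. *)
Lemma lebesgue_measure_translate (a : R) (A : set R) : measurable A ->
  pushforward mu (fun x : measurableTypeR R => x + a : measurableTypeR R)%R A = mu A.
Proof.
have mf : measurable_fun setT
    (fun x : measurableTypeR R => x + a : measurableTypeR R)%R.
  by apply: measurable_funD => //; exact: measurable_id.
pose f : {mfun _ >-> _} := HB.pack (fun x : measurableTypeR R =>
  x + a : measurableTypeR R)%R (isMeasurableFun.Build _ _ _ _ _ mf).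
move=> mA; apply/esym.
apply: (@lebesgue_measure_unique R (pushforward mu f)) => //= _ [[x y]] _ <-.
rewrite /pushforward.
have -> : (f @^-1` `]x, y])%classic = `](x - a)%R, (y - a)%R]%classic.
  by apply/seteqP; split => z /=; rewrite !in_itv/= ltrBlDr lerBrDr.
rewrite !lebesgue_measure_itv/= !lte_fin ltrD2r.
by congr (if _ then _%:E else _); ring.
Qed.

Lemma integral_translate (a : R) (h : R -> \bar R) : nnm h ->
  \int[mu]_x h (x + a)%R = \int[mu]_x h x.
Proof.
move=> [mh h0].
have mf : measurable_fun setT
    (fun x : measurableTypeR R => x + a : measurableTypeR R)%R.
  by apply: measurable_funD => //; exact: measurable_id.
pose f : {mfun _ >-> _} := HB.pack (fun x : measurableTypeR R =>
  x + a : measurableTypeR R)%R (isMeasurableFun.Build _ _ _ _ _ mf).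
transitivity (\int[pushforward mu f]_x h x).
  by rewrite (ge0_integral_pushforward mf).
by apply: eq_measure_integral => A mA _; apply: lebesgue_measure_translate.
Qed.

Lemma lebesgue_measure_scale (c : R) (c0 : (0 < c)%R) (A : set R) : measurable A ->
  c%:E * pushforward mu (fun x : measurableTypeR R => c * x : measurableTypeR R)%R A
  = mu A.
Proof.
have mf : measurable_fun setT
    (fun x : measurableTypeR R => c * x : measurableTypeR R)%R.
  by apply: measurable_funM => //; exact: measurable_id.
pose f : {mfun _ >-> _} := HB.pack (fun x : measurableTypeR R =>
  c * x : measurableTypeR R)%R (isMeasurableFun.Build _ _ _ _ _ mf).
pose k : {nonneg R} := NngNum (ltW c0).
move=> mA; apply/esym.
apply: (@lebesgue_measure_unique R (mscale k (pushforward mu f))) => //= _ [[x y]] _ <-.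
rewrite /mscale/= /pushforward.
have -> : (f @^-1` `]x, y])%classic = `](c^-1 * x)%R, (c^-1 * y)%R]%classic.
  apply/seteqP; split => z /=; rewrite !in_itv/=;
  by rewrite ler_pdivlMl// ltr_pdivrMl.
rewrite !lebesgue_measure_itv/= !lte_fin ltr_pM2l ?invr_gt0//.
case: ifPn => _; last by rewrite mule0.
by rewrite -EFinM mulrBr !mulrA divff ?mul1r// gt_eqF.
Qed.

Lemma integral_scale (c : R) (h : R -> \bar R) : (0 < c)%R -> nnm h ->
  c%:E * \int[mu]_x h (c * x)%R = \int[mu]_x h x.
Proof.
move=> c0 [mh h0].
have mf : measurable_fun setT
    (fun x : measurableTypeR R => c * x : measurableTypeR R)%R.
  by apply: measurable_funM => //; exact: measurable_id.
pose f : {mfun _ >-> _} := HB.pack (fun x : measurableTypeR R =>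
  c * x : measurableTypeR R)%R (isMeasurableFun.Build _ _ _ _ _ mf).
pose k : {nonneg R} := NngNum (ltW c0).
transitivity (\int[pushforward (mscale k mu) f]_x h x).
  rewrite (ge0_integral_pushforward mf)//.
  rewrite preimage_setT ge0_integral_mscale//.
    exact: (measurableT_comp mh mf).
  by move=> x _; exact: h0.
by apply: eq_measure_integral => A mA _; apply: lebesgue_measure_scale.
Qed.

End affine_change_of_variables.

Section convolution.
Context {R : realType}.
Local Notation mu := (@lebesgue_measure R).

Lemma nnm_integral {d} {T : measurableType d} (f : T -> R -> \bar R) :
  nnm (fun z : T * R => f z.1 z.2) -> nnm (fun x => \int[mu]_y f x y).
Proof.
move=> mf.
exact: (@nnm_fubini R _ _ T (measurableTypeR R) mu (fun z => f z.1 z.2)).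
Qed.

Lemma tonelli (f : R -> R -> \bar R) : nnm (fun z : R * R => f z.1 z.2) ->
  \int[mu]_x \int[mu]_y f x y = \int[mu]_y \int[mu]_x f x y.
Proof.
move=> [mf f0].
exact: (@fubini_tonelli _ _ (measurableTypeR R) (measurableTypeR R) R mu mu
  (fun z => f z.1 z.2) mf f0).
Qed.

(** The integral runs over the whole line; for functions that vanish on x <= 0 it reduces to 0 < v <
    s. *)
Definition conv (a b : R -> \bar R) (s : R) : \bar R :=
  \int[mu]_v (a v * b (s - v)%R).

Lemma nnm_conv (a b : R -> \bar R) : nnm a -> nnm b -> nnm (conv a b).
Proof.
move=> ma mb; have -> : conv a b = (fun s => \int[mu]_v (a v * b (s - v)%R)) by [].
apply: (@nnm_integral _ R (fun s v => a v * b (s - v)%R)).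
apply: nnmM; first exact: nnm_comp.
by apply: nnm_comp => //; exact: measurable_funB.
Qed.

Lemma conv_left_comm (a b c : R -> \bar R) (s : R) : nnm a -> nnm b -> nnm c ->
  conv a (conv b c) s = conv b (conv a c) s.
Proof.
move=> ma mb mc; rewrite /conv.
pose f (z : R * R) := a z.1 * (b z.2 * c (s - z.1 - z.2)%R).
have mf : nnm f.
  apply: nnmM; first exact: nnm_comp.
  apply: nnmM; first exact: nnm_comp.
  apply: nnm_comp => //.
  by apply: measurable_funB => //; exact: measurable_funB.
transitivity (\int[mu]_x \int[mu]_y f (x, y)).
  apply: eq_integral => x _; rewrite -integral_nnmZ//; first by case: ma.
  apply: nnmM => //; apply: nnm_comp => //.
  exact: measurable_funB.
rewrite (tonelli (f := fun x y => f (x, y)) mf).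
apply: eq_integral => y _; rewrite -integral_nnmZ//; last 2 first.
- by case: mb.
- by apply: nnmM => //; apply: nnm_comp => //; exact: measurable_funB.
by apply: eq_integral => x _; rewrite /f/= muleCA addrAC.
Qed.

(** In the double integral, x is the first piece and y the sum of the first two; a translation by x
    passes from the second piece to y. *)
Lemma conv_assoc (a b c : R -> \bar R) (s : R) : nnm a -> nnm b -> nnm c ->
  conv a (conv b c) s = conv (conv a b) c s.
Proof.
move=> ma mb mc; rewrite /conv.
pose f (z : R * R) := a z.1 * (b (z.2 - z.1)%R * c (s - z.2)%R).
have mf : nnm f.
  apply: nnmM; first exact: nnm_comp.
  apply: nnmM; first by apply: nnm_comp => //; exact: measurable_funB.
  by apply: nnm_comp => //; exact: measurable_funB.
transitivity (\int[mu]_x \int[mu]_y f (x, y)).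
  apply: eq_integral => x _.
  have mb' : nnm (fun y : R => b (y - x)%R * c (s - y)%R).
    apply: nnmM; apply: nnm_comp => //; exact: measurable_funB.
  rewrite /f/= (integral_nnmZ mu _ mb'); last by case: ma.
  congr (_ * _); rewrite -(integral_translate x mb').
  by apply: eq_integral => y _; rewrite addrK opprD addrA addrAC.
rewrite (tonelli (f := fun x y => f (x, y)) mf).
apply: eq_integral => y _.
rewrite muleC -integral_nnmZ//; last 2 first.
- by case: mc.
- by apply: nnmM => //; apply: nnm_comp => //; exact: measurable_funB.
by apply: eq_integral => x _; rewrite /f/= muleA muleC.
Qed.

End convolution.

(** * The stick-breaking operator *)

Section stick_operator.
Context {R : realType}.
Local Notation mu := (@lebesgue_measure R).

(* With [h x = x rho(x)] and [Psi = f], this is [f(s)] times the expectation of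
   [phi(G)] for [G] of density [ftilde(. | s)]. *)
Definition Lop (h phi Psi : R -> \bar R) (s : R) : \bar R :=
  \int[mu]_g ((phi g * ((\1_I01R g)%:E * h (g * s)%R)) * Psi (s * (1 - g))%R).

(** The chance that [a] specified points fall on a stick of fraction g and [c] specified points
    beyond it. The indicator makes it nonnegative on the whole line, as [nnm] asks. *)
Definition pw (a c : nat) (g : R) : \bar R :=
  (\1_I01R g * (g ^+ a * (1 - g) ^+ c))%:E.

Definition left0 (f : R -> \bar R) := forall x : R, (x <= 0)%R -> f x = 0.

(** For h(x) = x r(x), [mon a h] is x^n r(x), the factor of a block of size n = a + 1. *)
Definition mon (a : nat) (f : R -> \bar R) (x : R) : \bar R := (x ^+ a)%:E * f x.

Lemma measurable_I01R : measurable (I01R : set R).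
Proof. exact: measurable_itv. Qed.

Lemma I01RP (g : R) : I01R g -> (0 < g)%R /\ (0 < 1 - g)%R.
Proof. by rewrite /I01R/= in_itv/= => /andP[? ?]; split=> //; rewrite subr_gt0. Qed.

Lemma indic_I01RP (g : R) :
  ((\1_I01R g = 1%R :> R) /\ I01R g) \/ ((\1_I01R g = 0%R :> R) /\ ~ I01R g).
Proof.
rewrite indicE; case: (boolP (g \in I01R)) => [/set_mem|]; first by left.
by rewrite notin_setE; right.
Qed.

Lemma nnm_pw a c : nnm (pw a c).
Proof.
apply: nnm_EFin.
  apply: measurable_funM.
    by apply: measurable_indic; exact: measurable_I01R.
  apply: measurable_funM; apply: measurable_funX => //.
  exact: measurable_funB.
move=> g; have [[-> /I01RP[g0 g1]]|[-> _]] := indic_I01RP g; last by rewrite mul0r.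
by rewrite mul1r mulr_ge0// exprn_ge0 ?ltW.
Qed.

Lemma left0_mon {a : nat} {f : R -> \bar R} : left0 f -> left0 (mon a f).
Proof. by move=> f0 x x0; rewrite /mon f0// mule0. Qed.

Lemma nnm_mon a f : nnm f -> left0 f -> nnm (mon a f).
Proof.
move=> [mf f0] lf; split.
  apply: emeasurable_funM => //.
  by apply/measurable_EFinP; apply: measurable_funX.
move=> x; have [x0|x0] := leP x 0%R; first by rewrite left0_mon.
by rewrite mule_ge0// lee_fin exprn_ge0 ?ltW.
Qed.

Section kernel.
Variable h : R -> \bar R.
Hypothesis mh : nnm h.

Lemma nnm_Lop_integrand phi Psi (s : R) : nnm phi -> nnm Psi ->
  nnm (fun g : R => (phi g * ((\1_I01R g)%:E * h (g * s)%R)) * Psi (s * (1 - g))%R).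
Proof.
move=> mphi mPsi; apply: nnmM; last first.
  apply: nnm_comp => //; apply: measurable_funM => //.
  exact: measurable_funB.
apply: nnmM => //; apply: nnmM; first exact: nnm_indic measurable_I01R.
by apply: nnm_comp => //; exact: measurable_funM.
Qed.

Lemma nnm_Lop phi Psi : nnm phi -> nnm Psi -> nnm (Lop h phi Psi).
Proof.
move=> mphi mPsi.
have -> : Lop h phi Psi = (fun s => \int[mu]_g
  ((phi g * ((\1_I01R g)%:E * h (g * s)%R)) * Psi (s * (1 - g))%R)) by [].
apply: (@nnm_integral _ _ R (fun (s g : R) =>
  (phi g * ((\1_I01R g)%:E * h (g * s)%R)) * Psi (s * (1 - g))%R)).
apply: nnmM; last first.
  apply: nnm_comp => //; apply: measurable_funM => //.
  exact: measurable_funB.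
apply: nnmM => //; first exact: nnm_comp.
apply: nnmM; last by apply: nnm_comp => //; exact: measurable_funM.
exact: (@nnm_comp R _ _ (R * R)%type R _ snd (nnm_indic measurable_I01R)).
Qed.

Lemma left0_Lop {phi Psi : R -> \bar R} : left0 h -> left0 (Lop h phi Psi).
Proof.
move=> lh x x0; apply: integral0_eq => g _.
have [[-> /I01RP[g0 g1]]|[-> _]] := indic_I01RP g; last by rewrite !(mul0e,mule0).
rewrite lh ?mule0 ?mul0e//.
by rewrite mulr_ge0_le0// ltW.
Qed.

Lemma LopDr phi P Q s : nnm phi -> nnm P -> nnm Q ->
  Lop h phi (fun x => P x + Q x) s = Lop h phi P s + Lop h phi Q s.
Proof.
move=> mphi mP mQ; rewrite -integral_nnmD; try exact: nnm_Lop_integrand.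
by apply: eq_integral => g _; rewrite ge0_muleDr//; [case: mP | case: mQ].
Qed.

Lemma LopDl phi phi' P s : nnm phi -> nnm phi' -> nnm P ->
  Lop h (fun x => phi x + phi' x) P s = Lop h phi P s + Lop h phi' P s.
Proof.
move=> mphi mphi' mP; rewrite -integral_nnmD; try exact: nnm_Lop_integrand.
apply: eq_integral => g _.
have hh0 : 0 <= (\1_I01R g)%:E * h (g * s)%R.
  by rewrite mule_ge0 ?lee_fin//; case: mh.
rewrite ge0_muleDl; [|by case: mphi|by case: mphi'].
by rewrite ge0_muleDl// mule_ge0//; [case: mphi | case: mphi'].
Qed.

Lemma LopZr phi c P s : 0 <= c -> nnm phi -> nnm P ->
  Lop h phi (fun x => c * P x) s = c * Lop h phi P s.
Proof.
move=> c0 mphi mP; rewrite -integral_nnmZ//; last exact: nnm_Lop_integrand.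
by apply: eq_integral => g _; rewrite muleCA.
Qed.

Lemma LopZl phi c P s : 0 <= c -> nnm phi -> nnm P ->
  Lop h (fun x => c * phi x) P s = c * Lop h phi P s.
Proof.
move=> c0 mphi mP; rewrite -integral_nnmZ//; last exact: nnm_Lop_integrand.
by apply: eq_integral => g _; rewrite -!muleA.
Qed.

Lemma Lop_sumr (I : Type) (r : seq I) phi (P : I -> R -> \bar R) s :
  nnm phi -> (forall i, nnm (P i)) ->
  Lop h phi (fun x => \sum_(i <- r) P i x) s = \sum_(i <- r) Lop h phi (P i) s.
Proof.
move=> mphi mP; elim: r => [|i r IHr].
  rewrite big_nil; apply: integral0_eq => g _.
  by rewrite big_nil mule0.
rewrite big_cons -IHr -LopDr//; last exact: nnm_sum.
by apply: eq_integral => g _; rewrite big_cons.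
Qed.

(** A stick only shrinks the argument, s (1 - g) < s, so the comparison of P and Q is needed on (0,
    s] alone. *)
Lemma le_Lop (phi phi' P Q : R -> \bar R) (s : R) : nnm phi -> nnm phi' -> nnm P -> nnm Q ->
  (0 < s)%R -> (forall g, I01R g -> phi g <= phi' g) ->
  (forall x, (0 < x <= s)%R -> P x <= Q x) -> Lop h phi P s <= Lop h phi' Q s.
Proof.
move=> mphi mphi' mP mQ s0 hphi PQ.
apply: le_integral_nnm; try exact: nnm_Lop_integrand.
move=> g; have [[-> gI]|[-> _]] := indic_I01RP g; last by rewrite !(mul0e,mule0).
have [g0 g1] := I01RP gI.
have h0 := mh.2; have [_ p0] := mphi; have [_ p'0] := mphi'.
have [_ P0] := mP.
rewrite mul1e; apply: lee_pmul.
- by rewrite mule_ge0.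
- by [].
- by rewrite lee_wpmul2r// hphi.
- by apply: PQ; rewrite mulr_gt0//= ler_piMr ?ltW// ltrBlDl ltrDr.
Qed.

Lemma eq_Lop (phi phi' P Q : R -> \bar R) (s : R) : (0 < s)%R -> (forall g, I01R g -> phi g = phi' g) ->
  (forall x, (0 < x <= s)%R -> P x = Q x) -> Lop h phi P s = Lop h phi' Q s.
Proof.
move=> s0 hphi PQ; apply: eq_integral => g _.
have [[-> gI]|[-> _]] := indic_I01RP g; last by rewrite !(mul0e,mule0).
have [g0 g1] := I01RP gI; rewrite hphi// PQ//.
by rewrite mulr_gt0//= ler_piMr ?ltW// ltrBlDl ltrDr.
Qed.

Lemma Lop_limr phi (P : (R -> \bar R)^nat) s : nnm phi -> (forall n, nnm (P n)) ->
  (forall x, {homo P^~ x : n m / (n <= m)%N >-> n <= m}) ->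
  Lop h phi (fun x => limn (P^~ x)) s = limn (fun n => Lop h phi (P n) s).
Proof.
move=> mphi mP ndP; rewrite /Lop -integral_nnm_lim.
- apply: eq_integral => g _; rewrite limn_nnmZ//.
  + rewrite mule_ge0//; first by case: mphi.
    by rewrite mule_ge0 ?lee_fin//; case: mh.
  + by move=> n; case: (mP n).
- by move=> n; exact: nnm_Lop_integrand.
- move=> g n m nm; rewrite lee_wpmul2l//; last exact: ndP.
  rewrite mule_ge0//; first by case: mphi.
  by rewrite mule_ge0 ?lee_fin//; case: mh.
Qed.

Lemma Lop_liml (phi : (R -> \bar R)^nat) P s : (forall n, nnm (phi n)) -> nnm P ->
  (forall x, {homo phi^~ x : n m / (n <= m)%N >-> n <= m}) ->
  Lop h (fun x => limn (phi^~ x)) P s = limn (fun n => Lop h (phi n) P s).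
Proof.
move=> mphi mP ndphi; rewrite /Lop -integral_nnm_lim.
- apply: eq_integral => g _; rewrite -muleA muleC -limn_nnmZ//.
  + by congr (limn _); apply/funext => n; rewrite muleC muleA.
  + rewrite mule_ge0//; last by case: mP.
    by rewrite mule_ge0 ?lee_fin//; case: mh.
  + by move=> n; case: (mphi n).
- by move=> n; exact: nnm_Lop_integrand.
- move=> g n m nm; rewrite -!muleA lee_wpmul2r//; last exact: ndphi.
  by rewrite mule_ge0 ?lee_fin// mule_ge0//; [case: mh | case: mP].
Qed.

Lemma le_Lopr phi (P Q : R -> \bar R) s : nnm phi -> nnm P -> nnm Q ->
  (forall x, P x <= Q x) -> Lop h phi P s <= Lop h phi Q s.
Proof.
move=> mphi mP mQ PQ.
apply: le_integral_nnm; try exact: nnm_Lop_integrand.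
move=> g; rewrite lee_wpmul2l//.
rewrite mule_ge0//; first by case: mphi.
by rewrite mule_ge0 ?lee_fin//; case: mh.
Qed.

Lemma le_Lopl (phi psi : R -> \bar R) P s : nnm phi -> nnm psi -> nnm P ->
  (forall x, phi x <= psi x) -> Lop h phi P s <= Lop h psi P s.
Proof.
move=> mphi mpsi mP PQ.
apply: le_integral_nnm; try exact: nnm_Lop_integrand.
move=> g; rewrite -!muleA lee_wpmul2r// mule_ge0 ?lee_fin//.
by rewrite mule_ge0//; [case: mh | case: mP].
Qed.

Hypothesis lh : left0 h.

(** Substitute v = g s: the powers of s are [a] from g^a, [c] from (1 - g)^c and one from dv = s dg.
    Vanishing of h and P on x <= 0 takes the place of the restriction of g to (0, 1). *)
Lemma Lop_scale a c (P : R -> \bar R) (s : R) : (0 < s)%R -> nnm P -> left0 P ->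
  (s ^+ (a + c).+1)%:E * Lop h (pw a c) P s = conv (mon a h) (mon c P) s.
Proof.
move=> s0 mP lP.
have mm : nnm (fun v : R => mon a h v * mon c P (s - v)%R).
  apply: nnmM; first exact: nnm_mon.
  by apply: nnm_comp; [exact: nnm_mon | exact: measurable_funB].
rewrite /conv -(integral_scale s0 mm) exprS EFinM -muleA; congr (_ * _).
rewrite -integral_nnmZ; last 2 first.
- by rewrite lee_fin exprn_ge0 ?ltW.
- by apply: nnm_Lop_integrand => //; exact: nnm_pw.
suff pt (g : R) : (s ^+ (a + c))%:E *
    ((pw a c g * ((\1_I01R g)%:E * h (g * s)%R)) * P (s * (1 - g))%R) =
    mon a h (s * g)%R * mon c P (s - s * g)%R.
  by apply: eq_integral => g _; exact: pt.
rewrite /pw; have [[-> gI]|[-> gI]] := indic_I01RP g.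
  rewrite mul1r mul1e /mon.
  have -> : (s - s * g = s * (1 - g))%R by rewrite mulrBr mulr1.
  rewrite [(s * g)%R]mulrC.
  move: (h (g * s)%R) (P (s * (1 - g))%R) => H X.
  rewrite muleACA -EFinM -[_ * H * X]muleA [LHS]muleA -EFinM.
  by congr (_%:E * _); rewrite !exprMn exprD; ring.
rewrite !(mul0r,mul0e,mule0).
have [g0|g0] := leP g 0%R.
  by rewrite left0_mon ?mul0e// mulr_ge0_le0// ltW.
have [g1|g1] := leP 1%R g.
  by rewrite (left0_mon lP) ?mule0// subr_le0 ler_peMr// ltW.
by exfalso; apply: gI; rewrite /I01R/= in_itv/= g0.
Qed.

(* Both sides integrate the same symmetric function of the first two pieces. *)
Lemma Lop_comm a b c (P : R -> \bar R) (s : R) : (0 < s)%R -> nnm P -> left0 P ->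
  Lop h (pw a (b + c).+1) (Lop h (pw b c) P) s =
  Lop h (pw b (a + c).+1) (Lop h (pw a c) P) s.
Proof.
move=> s0 mP lP.
(* All powers of s needed by the two uses of [Lop_scale]: a, b, c from the weights and one for each
   change of variables. *)
pose k := (a + b + c).+2.
have key a' b' : (a' + b' = a + b)%N ->
  (s ^+ k)%:E * Lop h (pw a' (b' + c).+1) (Lop h (pw b' c) P) s =
  conv (mon a' h) (conv (mon b' h) (mon c P)) s.
  move=> ab; have -> : k = (a' + (b' + c).+1).+1 by rewrite /k addnS addnA ab.
  have mL : nnm (Lop h (pw b' c) P) by apply: nnm_Lop => //; exact: nnm_pw.
  rewrite Lop_scale//; last exact: left0_Lop.
  rewrite /conv; apply: eq_integral => v _; congr (_ * _).
  have [sv|sv] := ltP 0%R (s - v)%R; first by rewrite -[RHS]/(conv (mon b' h) (mon c P) (s - v)%R) -Lop_scale.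
  rewrite (left0_mon (left0_Lop lh)) //; apply/esym; apply: integral0_eq => w _.
  have [w0|w0] := leP w 0%R; first by rewrite left0_mon ?mul0e.
  rewrite (left0_mon lP) ?mule0//.
  by rewrite subr_le0 (le_trans sv)// ltW.
have := key a b erefl; have := key b a (addnC _ _).
rewrite conv_left_comm; [|exact: nnm_mon..] => <-.
have : (s ^+ k != 0)%R by rewrite gt_eqF// exprn_gt0.
move: (s ^+ k)%R (Lop h _ _ s) (Lop h _ _ s) => r x y r0.
move=> /(congr1 (fun x => r^-1%:E * x)) /=.
by rewrite [LHS]muleA [RHS]muleA -EFinM mulVf// !mul1e.
Qed.

End kernel.
End stick_operator.

(** * Words in the stick operators as expectations along the sticks *)

Section words.
Context {R : realType}.
Variable h : R -> \bar R.
Hypothesis mh : nnm h.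
Implicit Types (phis : seq (R -> \bar R)) (P Q : R -> \bar R).

Fixpoint nnms (phis : seq (R -> \bar R)) : Prop :=
  if phis is phi :: phis' then nnm phi /\ nnms phis' else True.

Lemma nnms_cat s1 s2 : nnms (s1 ++ s2) <-> nnms s1 /\ nnms s2.
Proof. by elim: s1 => [|x s1 IH] /=; [tauto | rewrite IH; tauto]. Qed.

Lemma nnms_rcons s x : nnms s -> nnm x -> nnms (rcons s x).
Proof. by move=> ms mx; rewrite -cats1; apply/nnms_cat. Qed.

Lemma nnms_nseq n x : nnm x -> nnms (nseq n x).
Proof. by move=> mx; elim: n => //= n IH. Qed.

Definition word phis P : R -> \bar R := foldr (Lop h) P phis.

Lemma word_rcons phis phi P : word (rcons phis phi) P = word phis (Lop h phi P).
Proof. by rewrite /word foldr_rcons. Qed.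

Lemma word_cat s1 s2 P : word (s1 ++ s2) P = word s1 (word s2 P).
Proof. by rewrite /word foldr_cat. Qed.

Lemma nnm_word phis P : nnms phis -> nnm P -> nnm (word phis P).
Proof. by move=> + mP; elim: phis => //= x s IH [mx ms]; apply: nnm_Lop => //; exact: IH. Qed.

Lemma wordD phis P Q s : nnms phis -> nnm P -> nnm Q ->
  word phis (fun x => P x + Q x) s = word phis P s + word phis Q s.
Proof.
move=> + mP mQ; elim: phis s => //= x l IH s [mx ms].
rewrite -LopDr//; try exact: nnm_word.
by congr Lop; apply/funext => y; rewrite IH.
Qed.

Lemma wordZ phis c P s : 0 <= c -> nnms phis -> nnm P ->
  word phis (fun x => c * P x) s = c * word phis P s.
Proof.
move=> c0 + mP; elim: phis s => //= x l IH s [mx ms].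
rewrite -LopZr//; try exact: nnm_word.
by congr Lop; apply/funext => y; rewrite IH.
Qed.

Lemma word_sum (I : Type) (r : seq I) phis (P : I -> R -> \bar R) s :
  nnms phis -> (forall i, nnm (P i)) ->
  word phis (fun x => \sum_(i <- r) P i x) s = \sum_(i <- r) word phis (P i) s.
Proof.
move=> + mP; elim: phis s => //= x l IH s [mx ms].
rewrite -Lop_sumr//; last by move=> i; exact: nnm_word.
by congr Lop; apply/funext => y; rewrite IH.
Qed.

Lemma le_wordr phis P Q s : nnms phis -> nnm P -> nnm Q ->
  (forall x, P x <= Q x) -> word phis P s <= word phis Q s.
Proof.
move=> + mP mQ PQ; elim: phis s => //= x l IH s [mx ms].
by apply: le_Lopr => //; [exact: nnm_word | exact: nnm_word | move=> y; exact: IH].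
Qed.

Lemma le_word phis P Q s : nnms phis -> nnm P -> nnm Q -> (0 < s)%R ->
  (forall x, (0 < x <= s)%R -> P x <= Q x) -> word phis P s <= word phis Q s.
Proof.
move=> + mP mQ; elim: phis s => /= [|x l IH] s; first by move=> _ s0; apply; rewrite s0/=.
move=> [mx ms] s0 PQ.
apply: le_Lop => //; [exact: nnm_word | exact: nnm_word |].
move=> y /andP[y0 ys]; apply: IH => // z /andP[z0 zy].
by apply: PQ; rewrite z0/= (le_trans zy).
Qed.

Lemma eq_word phis P Q s : (0 < s)%R ->
  (forall x, (0 < x <= s)%R -> P x = Q x) -> word phis P s = word phis Q s.
Proof.
elim: phis s => /= [|x l IH] s s0 PQ; first by apply: PQ; rewrite s0/=.
apply: eq_Lop => // y /andP[y0 ys]; apply: IH => // z /andP[z0 zy].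
by apply: PQ; rewrite z0/= (le_trans zy).
Qed.

Lemma word_lim phis (P : (R -> \bar R)^nat) s : nnms phis -> (forall n, nnm (P n)) ->
  (forall x, {homo P^~ x : n m / (n <= m)%N >-> n <= m}) ->
  word phis (fun x => limn (P^~ x)) s = limn (fun n => word phis (P n) s).
Proof.
move=> + mP ndP; elim: phis s => //= x l IH s [mx ms].
rewrite -Lop_limr//.
- by congr Lop; apply/funext => y; rewrite IH.
- by move=> n; exact: nnm_word.
- by move=> y n m nm; apply: le_wordr => // z; exact: ndP.
Qed.

Fixpoint prodseq phis (g : nat -> R) : \bar R :=
  if phis is phi :: phis' then phi (g 0%N) * prodseq phis' (fun j => g j.+1) else 1.

Lemma prodseq_cat s1 s2 g :
  prodseq (s1 ++ s2) g = prodseq s1 g * prodseq s2 (fun j => g (size s1 + j)%N).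
Proof. by elim: s1 g => [|x l IH] g /=; rewrite ?mul1e// IH muleA. Qed.

Lemma prodseq_rcons s1 phi g :
  prodseq (rcons s1 phi) g = prodseq s1 g * phi (g (size s1)).
Proof. by rewrite -cats1 prodseq_cat/= mule1 addn0. Qed.

Section expectation.
Context {d : measure_display} {Omega : measurableType d}.
Variables (Pr : probability Omega R) (G : nat -> Omega -> R).
Hypothesis mG : forall j, measurable_fun setT (G j).
Variable F : R -> \bar R.
Hypothesis mF : nnm F.

Lemma nnm_prodseq phis : nnms phis -> nnm (fun w => prodseq phis (G ^~ w)).
Proof.
have : forall k, nnms phis -> nnm (fun w => prodseq phis (fun j => G (k + j)%N w)).
  elim: phis => [|x l IH] k /=; first by move=> _; exact: nnm_cst.
  move=> [mx ml]; apply: nnmM; first exact: nnm_comp.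
  have := IH k.+1 ml.
  by congr nnm; apply/funext => w; congr prodseq; apply/funext => j; rewrite addnS.
by move=> /(_ 0%N).
Qed.

Definition indicE_fun (B : set R) (x : R) : \bar R := (\1_B x)%:E.

Lemma nnms_indic (Bs : seq (set R)) : (forall i, measurable (nth setT Bs i)) ->
  nnms (map indicE_fun Bs).
Proof.
elim: Bs => //= B Bs IH mB; split; first exact: nnm_indic (mB 0%N).
by apply: IH => i; exact: (mB i.+1).
Qed.

(* Indicators are replaced by general functions one coordinate at a time. *)
Lemma expectation_word :
  (forall Bs : seq (set R), (forall i, measurable (nth setT Bs i)) ->
     F 1%R * \int[Pr]_w prodseq (map indicE_fun Bs) (G ^~ w) =
     word (map indicE_fun Bs) F 1%R) ->
  forall phis, nnms phis ->
    F 1%R * \int[Pr]_w prodseq phis (G ^~ w) = word phis F 1%R.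
Proof.
move=> HB phis mphis.
suff gen (Bs : seq (set R)) : (forall i, measurable (nth setT Bs i)) ->
    F 1%R * \int[Pr]_w prodseq (phis ++ map indicE_fun Bs) (G ^~ w) =
    word (phis ++ map indicE_fun Bs) F 1%R.
  by have := gen [::]; rewrite cats0; apply => i; rewrite nth_nil.
(* The list is consumed from its end: a last letter that is an indicator joins [Bs], and the
   induction hypothesis applies. *)
elim/last_ind: phis mphis Bs => [|l phi IH] ml Bs mBs; first exact: HB.
have [mll [mphi _]] : nnms l /\ nnms [:: phi].
  by apply/nnms_cat; rewrite cats1.
rewrite cat_rcons.
have mT := nnms_indic mBs.
have F1 : 0 <= F 1%R by case: mF.
pose A w := prodseq l (G ^~ w).
have mA : nnm A by exact: nnm_prodseq.
pose C w := prodseq (map indicE_fun Bs) (fun j => G (size l + j.+1)%N w).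
have mC : nnm C.
  (* Padding with constant letters 1 shifts the product to later sticks, which gives the
     measurability of C. *)
  have := @nnm_prodseq (nseq (size l).+1 (cst 1) ++ map indicE_fun Bs).
  have -> : (fun w => prodseq (nseq (size l).+1 (cst 1) ++ map indicE_fun Bs) (G ^~ w)) = C.
    apply/funext => w; rewrite prodseq_cat size_nseq.
    have -> : forall n g, prodseq (nseq n (cst 1)) g = 1.
      by elim=> //= n IHn g; rewrite IHn mul1e.
    by rewrite mul1e; congr prodseq; apply/funext => j; rewrite addSnnS.
  by apply; apply/nnms_cat; split => //; apply: nnms_nseq; exact: nnm_cst.
pose X := word (map indicE_fun Bs) F.
have mX : nnm X by exact: nnm_word.
have mI psi : nnm psi -> nnm (fun w => A w * (psi (G (size l) w) * C w)).
  by move=> mpsi; apply: nnmM => //; apply: nnmM => //; exact: nnm_comp.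
have A0 := mA.2; have C0 := mC.2.
have ndI (f : (R -> \bar R)^nat) :
  (forall x, {homo f^~ x : n m / (n <= m)%N >-> n <= m}) ->
  forall w, {homo (fun n => A w * (f n (G (size l) w) * C w)) :
    n m / (n <= m)%N >-> n <= m}.
  by move=> ndf w n m nm; rewrite lee_wpmul2l// lee_wpmul2r// ndf.
suff key psi : nnm psi ->
    F 1%R * \int[Pr]_w (A w * (psi (G (size l) w) * C w)) =
    word l (Lop h psi X) 1%R.
  rewrite word_cat/= -/X -key//; congr (_ * _).
  apply: eq_integral => w _; rewrite prodseq_cat/= addn0.
  by [].
move: psi; apply: nnm_ind.
- move=> B mB; rewrite /X.
  have := IH mll (B :: Bs); rewrite word_cat/= => <-; last by case.
  congr (_ * _); apply: eq_integral => w _; rewrite prodseq_cat/= addn0.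
  by [].
- move=> c f c0 mf IHf.
  transitivity (c%:E * (F 1%R * \int[Pr]_w (A w * (f (G (size l) w) * C w)))).
    rewrite muleCA -(integral_nnmZ Pr _ (mI _ mf)) ?lee_fin//.
    congr (_ * _); apply: eq_integral => w _. rewrite -muleA; exact: muleCA.
  rewrite IHf -wordZ ?lee_fin//; last exact: nnm_Lop.
  by congr word; apply/funext => x; rewrite LopZl.
- move=> f g mf mg IHf IHg.
  transitivity (F 1%R * \int[Pr]_w (A w * (f (G (size l) w) * C w)) +
                F 1%R * \int[Pr]_w (A w * (g (G (size l) w) * C w))).
    rewrite -ge0_muleDr; [|by apply: integral_nnm_ge0; exact: mI..].
    rewrite -integral_nnmD; [|exact: mI..].
    congr (_ * _); apply: eq_integral => w _.
    have f0 := mf.2; have g0 := mg.2.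
    by rewrite ge0_muleDl// ge0_muleDr// mule_ge0.
  rewrite IHf IHg -wordD//; [|exact: nnm_Lop..].
  by congr word; apply/funext => x; rewrite LopDl.
- move=> f mf ndf IHf.
  transitivity (limn (fun n => F 1%R * \int[Pr]_w (A w * (f n (G (size l) w) * C w)))).
    rewrite limn_nnmZ//; last 2 first.
    + by move=> n; apply: integral_nnm_ge0; exact: mI.
    + move=> n m nm; apply: le_integral_nnm; [exact: mI|exact: mI|].
      by move=> w; exact: (ndI f).
    rewrite -integral_nnm_lim; [|by move=> n; exact: mI|exact: ndI].
    congr (_ * _); apply: eq_integral => w _; have f0 n := (mf n).2.
    rewrite limn_nnmZ//; last 2 first.
    + by move=> n; rewrite mule_ge0.
    + by move=> n m nm; rewrite lee_wpmul2r// ndf.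
    congr (_ * _); rewrite muleC -limn_nnmZ//.
    by congr (limn _); apply/funext => n; rewrite muleC.
  under eq_fun do rewrite IHf.
  rewrite -word_lim//.
  + by congr word; apply/funext => x; rewrite Lop_liml.
  + by move=> n; exact: nnm_Lop.
  + by move=> x n m nm; apply: le_Lopl => // y; exact: ndf.
Qed.

End expectation.
End words.

(** * The occupancy recursion *)

Section occupancy_system.
Context {R : realType}.
Variables h F : R -> \bar R.
Hypotheses (mh : nnm h) (lh : left0 h) (mF : nnm F) (lF : left0 F).
Implicit Types (phis : seq (R -> \bar R)) (l : seq nat).

(* Lists hold the block sizes minus one. *)
Definition wt (l : seq nat) : nat := sumn (map succn l).

Fixpoint What (l : seq nat) : R -> \bar R :=
  if l is a :: l' then Lop h (pw a (wt l')) (What l') else F.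

(** One entry per position, so blocks of equal size are counted separately; the order of the
    remaining blocks is kept. *)
Fixpoint picks (l : seq nat) : seq (nat * seq nat) :=
  if l is a :: l' then (a, l') :: [seq (p.1, a :: p.2) | p <- picks l'] else [::].

Lemma wt_cons a l : wt (a :: l) = (a + wt l).+1.
Proof. by []. Qed.

Lemma What_cons a l : What (a :: l) = Lop h (pw a (wt l)) (What l).
Proof. by []. Qed.

Lemma wt_picks l p : p \in picks l -> wt l = (p.1.+1 + wt p.2)%N.
Proof.
elim: l p => //= a l IH p; rewrite in_cons => /orP[/eqP -> //|].
by move=> /mapP[q ql ->]; rewrite /wt/= -/(wt _) -/(wt _) (IH _ ql) addnCA.
Qed.

Lemma size_picks2 l p : p \in picks l -> size l = (size p.2).+1.
Proof.
elim: l p => //= a l IH p; rewrite in_cons => /orP[/eqP -> //|].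
by move=> /mapP[q ql ->] /=; rewrite (IH _ ql).
Qed.

Lemma size_picks l : size (picks l) = size l.
Proof. by elim: l => //= a l IH; rewrite size_map IH. Qed.

Lemma leq_size_wt l : (size l <= wt l)%N.
Proof. by elim: l => //= a l IH; rewrite /wt/= -/(wt _) addSn ltnS (leq_trans IH)// leq_addl. Qed.

(* The first stick is avoided by every block, or taken by exactly one of them. *)
Definition occ (Psi : seq nat -> R -> \bar R) (l : seq nat) (s : R) : \bar R :=
  Lop h (pw 0 (wt l)) (Psi l) s +
  \sum_(p <- picks l) Lop h (pw p.1.+1 (wt p.2)) (Psi p.2) s.

Lemma nnm_What l : nnm (What l).
Proof. by elim: l => //= a l IH; apply: nnm_Lop => //; exact: nnm_pw. Qed.

Lemma left0_What l : left0 (What l).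
Proof. by case: l => //= a l; exact: left0_Lop. Qed.

Lemma nnm_occ Psi : (forall l, nnm (Psi l)) -> forall l, nnm (occ Psi l).
Proof.
move=> mPsi l; apply: nnmD; first by apply: nnm_Lop => //; exact: nnm_pw.
by apply: nnm_sum => p; apply: nnm_Lop => //; exact: nnm_pw.
Qed.

Lemma nnm_iter_occ Psi : (forall l, nnm (Psi l)) -> forall M l, nnm (iter M occ Psi l).
Proof. by move=> mPsi; elim => //= M IH; exact: nnm_occ. Qed.

Lemma word_occ phis Psi l s : nnms phis -> (forall l, nnm (Psi l)) ->
  word h phis (occ Psi l) s = word h (rcons phis (pw 0 (wt l))) (Psi l) s +
    \sum_(p <- picks l) word h (rcons phis (pw p.1.+1 (wt p.2))) (Psi p.2) s.
Proof.
move=> mphis mPsi; rewrite wordD//; last 2 first.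
- by apply: nnm_Lop => //; exact: nnm_pw.
- by apply: nnm_sum => p; apply: nnm_Lop => //; exact: nnm_pw.
rewrite word_sum//; last by move=> p; apply: nnm_Lop => //; exact: nnm_pw.
rewrite word_rcons; congr (_ + _).
by apply: eq_bigr => p _; rewrite word_rcons.
Qed.

Lemma occD P Q l s : (forall l, nnm (P l)) -> (forall l, nnm (Q l)) ->
  occ (fun l x => P l x + Q l x) l s = occ P l s + occ Q l s.
Proof.
move=> mP mQ; rewrite /occ LopDr//; last exact: nnm_pw.
rewrite [RHS]addeACA; congr (_ + _); rewrite -big_split.
by apply: eq_bigr => p _; rewrite LopDr//; exact: nnm_pw.
Qed.

(** The initial datum [What] is cut in two. Iterating [occ] from [only_nil] counts the placements of
    all blocks on the first M sticks; from [off_nil] it gives the error, where some block is still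
    unplaced. *)
Definition only_nil l : R -> \bar R := if l is [::] then F else cst 0.
Definition off_nil l : R -> \bar R := if l is [::] then cst 0 else What l.

Lemma nnm_only_nil l : nnm (only_nil l).
Proof. by case: l => // *; exact: nnm_cst. Qed.

Lemma nnm_off_nil l : nnm (off_nil l).
Proof. by case: l => [|a l]; [exact: nnm_cst | exact: nnm_What]. Qed.

Lemma iter_occ_split M l s :
  iter M occ What l s = iter M occ only_nil l s + iter M occ off_nil l s.
Proof.
elim: M l s => [|M IH] l s /=; first by case: l => [|a l] /=; rewrite ?adde0 ?add0e.
rewrite -occD; [|exact: (nnm_iter_occ nnm_only_nil)|exact: (nnm_iter_occ nnm_off_nil)].
by congr occ; apply/funext => l'; apply/funext => x; exact: IH.
Qed.

Lemma pw00 g : I01R g -> (pw 0 0 g : \bar R) = 1.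
Proof.
by move=> gI; rewrite /pw; have [[-> _]|[_ //]] := indic_I01RP g; rewrite !expr0 !mulr1.
Qed.

Lemma pwS a c (g : R) : pw a c g = pw a.+1 c g + pw a c.+1 g.
Proof. by rewrite /pw -EFinD; congr EFin; rewrite !exprS; ring. Qed.

Lemma pw_le a b c d (g : R) : (c <= a)%N -> (d <= b)%N -> pw a b g <= pw c d g.
Proof.
move=> ca db; rewrite /pw lee_fin.
have [[-> /I01RP[g0 g1]]|[-> _]] := indic_I01RP g; last by rewrite !mul0r.
have [g0' g1'] : (g <= 1)%R /\ (1 - g <= 1)%R by split; lra.
by rewrite !mul1r ler_pM ?exprn_ge0 ?ler_wiXn2l// ltW.
Qed.

Hypothesis consistency : forall phis, nnms phis ->
  word h phis (Lop h (cst 1) F) 1%R = word h phis F 1%R.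

(** For a :: l, the part of the weight with the extra factor g is the term in which this block takes
    the first stick. For the part with 1 - g, the induction hypothesis on l is applied behind the
    extended word [rcons phis (pw a w.+1)]; [Lop_comm] then moves the stick of block a behind the
    one just split off, which yields the remaining terms of [occ]. *)
Lemma What_occ phis l : nnms phis ->
  word h phis (What l) 1%R = word h phis (occ What l) 1%R.
Proof.
elim: l phis => [|a l IH] phis mphis.
  rewrite -consistency//; apply: eq_word => // x /andP[x0 _].
  by rewrite /occ big_nil adde0; apply: eq_Lop => // g gI; rewrite pw00.
pose w := wt l.
pose P s := Lop h (pw 0 (wt (a :: l))) (What (a :: l)) s +
  \sum_(p <- picks l) Lop h (pw p.1.+1 (wt (a :: p.2))) (What (a :: p.2)) s.
have mP : nnm P.
  apply: nnmD; first by apply: nnm_Lop; [|exact: nnm_pw|exact: nnm_What].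
  by apply: nnm_sum => p; apply: nnm_Lop; [|exact: nnm_pw|exact: nnm_What].
have mA : nnm (Lop h (pw a.+1 w) (What l)).
  by apply: nnm_Lop; [|exact: nnm_pw|exact: nnm_What].
transitivity (word h phis (fun s => Lop h (pw a.+1 w) (What l) s + P s) 1%R); last first.
  congr word; apply/funext => s; rewrite /occ/= big_cons big_map /P/=.
  by rewrite addeCA.
rewrite wordD//.
have mB : nnm (Lop h (pw a w.+1) (What l)).
  by apply: nnm_Lop; [|exact: nnm_pw|exact: nnm_What].
have -> : What (a :: l) = (fun s =>
    Lop h (pw a.+1 w) (What l) s + Lop h (pw a w.+1) (What l) s).
  apply/funext => s.
  transitivity (Lop h (fun g => pw a.+1 w g + pw a w.+1 g) (What l) s).
    by congr (Lop h _ _ s); apply/funext => g; exact: pwS.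
  exact: (LopDl mh s (nnm_pw _ _) (nnm_pw _ _) (nnm_What l)).
rewrite (wordD mh 1%R mphis mA mB).
have -> : word h phis (Lop h (pw a w.+1) (What l)) 1%R =
    word h (rcons phis (pw a w.+1)) (What l) 1%R by rewrite word_rcons.
congr (_ + _); rewrite IH; last by apply: nnms_rcons => //; exact: nnm_pw.
rewrite word_rcons; apply: eq_word => // s /andP[s0 _].
have mpk (p : nat * seq nat) : nnm (Lop h (pw p.1.+1 (wt p.2)) (What p.2)).
  by apply: nnm_Lop; [|exact: nnm_pw|exact: nnm_What].
have m0 : nnm (Lop h (pw 0 w) (What l)).
  by apply: nnm_Lop; [|exact: nnm_pw|exact: nnm_What].
rewrite (LopDr mh s (nnm_pw a w.+1) m0 (nnm_sum (picks l) mpk)).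
rewrite (Lop_sumr mh (picks l) s (nnm_pw a w.+1) mpk).
rewrite (Lop_comm mh lh a 0 w s0 (nnm_What l) (left0_What l)).
rewrite /P /w wt_cons What_cons.
apply: (congr1 (fun y => _ + y)); apply: eq_big_seq => p pl.
rewrite wt_cons What_cons (wt_picks pl).
exact: (Lop_comm mh lh a p.1.+1 (wt p.2) s0 (nnm_What p.2) (left0_What p.2)).
Qed.

Lemma What_iter_occ M phis l : nnms phis ->
  word h phis (What l) 1%R = word h phis (iter M occ What l) 1%R.
Proof.
elim: M phis l => //= M IH phis l mphis.
rewrite What_occ// !word_occ//; [|exact: (nnm_iter_occ nnm_What)|exact: nnm_What].
rewrite IH; last by apply: nnms_rcons => //; exact: nnm_pw.
congr (_ + _); apply: eq_bigr => p _.
by rewrite IH//; apply: nnms_rcons => //; exact: nnm_pw.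
Qed.

Lemma le_word_letter phis phi psi P s : nnms phis -> nnm phi -> nnm psi -> nnm P ->
  (forall g, phi g <= psi g) ->
  word h (rcons phis phi) P s <= word h (rcons phis psi) P s.
Proof.
move=> mphis mphi mpsi mP le; rewrite !word_rcons.
apply: le_wordr => //; [exact: nnm_Lop|exact: nnm_Lop|].
by move=> x; exact: le_Lopl.
Qed.

Lemma pw_le1 a b (g : R) : pw a b g <= 1.
Proof.
apply: (le_trans (pw_le g (leq0n a) (leq0n b))).
by rewrite /pw !expr0 !mulr1 lee_fin indicE lern1 leq_b1.
Qed.

Lemma What_le phis l : nnms phis -> word h phis (What l) 1%R <= word h phis F 1%R.
Proof.
elim: l phis => //= a l IH phis mphis.
have m1 : nnm (cst 1 : R -> \bar R) by exact: nnm_cst.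
rewrite -word_rcons; apply: (@le_trans _ _ (word h (rcons phis (cst 1)) (What l) 1%R)).
  apply: le_word_letter => //; [exact: nnm_pw|exact: nnm_What|].
  by move=> g; exact: pw_le1.
apply: (le_trans (IH _ _)); first exact: nnms_rcons.
by rewrite word_rcons consistency.
Qed.

Definition remaining M : R -> \bar R := iter M (Lop h (pw 0 1)) F.

Lemma nnm_remaining M : nnm (remaining M).
Proof. by elim: M => //= M IH; apply: nnm_Lop => //; exact: nnm_pw. Qed.

(** For j > 0, divide by x: x^j + j (1 - x) x^(j-1) is the probability of at most one failure in j
    independent trials with success probability x. *)
Lemma expr_bernoulli (x : R) j : (0 <= x <= 1)%R ->
  (x ^+ j.+1 + j%:R * ((1 - x) * x ^+ j) <= x)%R.
Proof.
move=> /andP[x0 x1]; case: j => [|j]; first by rewrite mul0r addr0 expr1.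
have IH : (x ^+ j.+1 + j.+1%:R * ((1 - x) * x ^+ j) <= 1)%R.
  elim: j => [|j IH]; first by rewrite expr1 expr0; lra.
  have e1 : (x * (x ^+ j.+1 + j.+1%:R * ((1 - x) * x ^+ j)) <= x * 1)%R.
    by rewrite ler_wpM2l.
  have e2 : ((1 - x) * x ^+ j.+1 <= (1 - x) * 1)%R.
    by rewrite ler_wpM2l ?subr_ge0// exprn_ile1.
  apply: le_trans (_ : x * 1 + (1 - x) * 1 <= 1)%R; last by lra.
  apply: le_trans (lerD e1 e2); rewrite le_eqVlt; apply/orP; left; apply/eqP.
  by rewrite [j.+2%:R]mulrS !exprS; ring.
have := ler_wpM2l x0 IH; rewrite mulr1; apply: le_trans.
by rewrite le_eqVlt; apply/orP; left; apply/eqP; rewrite !exprS; ring.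
Qed.

(** A union bound over the unplaced blocks, each treated as if it were a single point
    ([size l <= wt l]). With j + 1 blocks, one stick multiplies the bound j + 1 by (1 - g)^(j+1) if
    it is avoided; each of the j + 1 picks leaves the bound j with weight at most g (1 - g)^j. By
    [expr_bernoulli] at x = 1 - g the total is at most (j + 1)(1 - g). *)
Lemma off_nil_le M phis l : nnms phis ->
  word h phis (iter M occ off_nil l) 1%R <=
  (size l)%:R%:E * word h phis (remaining M) 1%R.
Proof.
elim: M phis l => [|M IH] phis l mphis.
  have w0 := (nnm_word mh mphis mF).2.
  case: l => [|a l].
    (* The zero function is written as a multiple of F so that [wordZ] evaluates it. *)
    have -> : iter 0 occ off_nil [::] = (fun x => 0 * F x).
      by apply/funext => x; rewrite mul0e.
    by rewrite wordZ// !mul0e.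
  apply: (le_trans (What_le (a :: l) mphis)).
  by rewrite -[leLHS]mul1e; apply: lee_wpmul2r => //; rewrite lee_fin ler1n.
rewrite [iter _ _ _ _]/= word_occ//; last exact: (nnm_iter_occ nnm_off_nil).
have mX := nnm_remaining M.
have mpw a b : nnms (rcons phis (pw a b)) by apply: nnms_rcons => //; exact: nnm_pw.
have wpw a b := (nnm_word mh (mpw a b) mX).2 1%R.
case E : (size l) => [|j].
  move/size0nil : E => ->; rewrite big_nil adde0 mul0e.
  by apply: (le_trans (IH _ _ (mpw _ _))); rewrite mul0e.
pose A := word h (rcons phis (pw 0 j.+1)) (remaining M) 1%R.
pose B := word h (rcons phis (pw 1 j)) (remaining M) 1%R.
apply: (@le_trans _ _ (j.+1%:R%:E * A + j.+1%:R%:E * (j%:R%:E * B))).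
  apply: leeD.
    apply: (le_trans (IH _ _ (mpw _ _))); rewrite E; apply: lee_wpmul2l => //.
    apply: le_word_letter => //; [exact: nnm_pw..|move=> g].
    by apply: pw_le => //; rewrite -E leq_size_wt.
  apply: (@le_trans _ _ (\sum_(p <- picks l) (j%:R%:E * B))).
    rewrite big_seq [leRHS]big_seq; apply: lee_sum => p pl.
    have Ep : size p.2 = j by have := size_picks2 pl; rewrite E => -[].
    apply: (le_trans (IH _ _ (mpw _ _))); rewrite Ep; apply: lee_wpmul2l => //.
    apply: le_word_letter => //; [exact: nnm_pw..|move=> g].
    by apply: pw_le => //; rewrite -Ep leq_size_wt.
  rewrite big_const_seq count_predT size_picks E.
  have : 0 <= j%:R%:E * B by apply: mule_ge0; [rewrite lee_fin | exact: wpw].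
  move: (j%:R%:E * B) => y y0.
  suff -> : iter j.+1 (adde y) 0 = j.+1%:R%:E * y by [].
  elim: (j.+1) => [|k IHk]; first by rewrite mul0e.
  by rewrite iterS IHk -[k.+1%:R]natr1 EFinD ge0_muleDl ?lee_fin// mul1e addeC.
have j0 : 0 <= j%:R%:E :> \bar R by rewrite lee_fin.
rewrite -ge0_muleDr; [|exact: wpw|by apply: mule_ge0; [|exact: wpw]].
apply: lee_wpmul2l => //.
rewrite /A /B !word_rcons.
have mL a b : nnm (Lop h (pw a b) (remaining M)) by apply: nnm_Lop => //; exact: nnm_pw.
rewrite -wordZ// -wordD//; last by apply: nnmM => //; exact: nnm_cst.
apply: le_wordr => //.
- by apply: nnmD => //; apply: nnmM => //; exact: nnm_cst.
- exact: (nnm_remaining M.+1).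
- move=> x; have mj : nnm (fun g => j%:R%:E * pw 1 j g : \bar R).
    by apply: nnmM; [exact: nnm_cst | exact: nnm_pw].
  rewrite -(LopZl mh x j0 (nnm_pw 1 j) mX) -(LopDl mh x (nnm_pw 0 j.+1) mj mX).
  apply: le_Lopl => //; [by apply: nnmD => //; exact: nnm_pw|exact: nnm_pw|].
  move=> g; rewrite /pw -EFinM -EFinD lee_fin.
  have [[-> /I01RP[g0 g1]]|[-> _]] := indic_I01RP g; last by rewrite !(mul0r, mulr0, addr0).
  rewrite ?(mul1r, expr0, expr1).
  have := @expr_bernoulli (1 - g)%R j; have -> : (1 - (1 - g) = g)%R by ring.
  by apply; apply/andP; split; lra.
Qed.

End occupancy_system.

(** * The remaining mass tends to zero *)

Section remaining_mass.
Context {R : realType}.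
Local Notation mu := (@lebesgue_measure R).
Variables (h : R -> \bar R) (F : R -> R).
Local Notation FE := (fun x => (F x)%:E).
Hypotheses (mh : nnm h) (lh : left0 h) (mF : nnm FE) (lF : left0 FE).
Hypothesis F_pos : forall x : R, (0 < x)%R -> (0 < F x)%R.
Hypothesis F_cont : {in posR, continuous F}.
Hypothesis consistency : forall phis, nnms phis ->
  word h phis (Lop h (cst 1) FE) 1%R = word h phis FE 1%R.

Lemma posRP (x : R) : posR x <-> (0 < x)%R.
Proof. by rewrite /posR/= in_itv/= andbT. Qed.

Lemma F_lower_bound (e : R) : (0 < e)%R ->
  exists2 m : R, (0 < m)%R & forall x, (e <= x <= 1)%R -> (m <= F x)%R.
Proof.
move=> e0; have [e1|e1] := leP e 1%R; last first.
  by exists 1%R => // x /andP[ex x1]; have := lt_le_trans e1 (le_trans ex x1); rewrite ltxx.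
have cF : {within `[e, 1%R], continuous F}.
  apply: continuous_in_subspaceT => x /set_mem/=; rewrite in_itv/= => /andP[ex _].
  by apply: F_cont; apply/mem_set/posRP; exact: lt_le_trans ex.
have [c cI cmin] := EVT_min e1 cF.
exists (F c); last by move=> x xe; apply: cmin; rewrite in_itv.
by apply: F_pos; move: cI; rewrite in_itv/= => /andP[ec _]; exact: lt_le_trans ec.
Qed.

Lemma F_upper_bound (e : R) : (0 < e)%R ->
  exists2 m : R, (0 < m)%R & forall x, (e <= x <= 1)%R -> (F x <= m)%R.
Proof.
move=> e0; have [e1|e1] := leP e 1%R; last first.
  by exists 1%R => // x /andP[ex x1]; have := lt_le_trans e1 (le_trans ex x1); rewrite ltxx.
have cF : {within `[e, 1%R], continuous F}.
  apply: continuous_in_subspaceT => x /set_mem/=; rewrite in_itv/= => /andP[ex _].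
  by apply: F_cont; apply/mem_set/posRP; exact: lt_le_trans ex.
have [c cI cmax] := EVT_max e1 cF.
exists (F c); last by move=> x xe; apply: cmax; rewrite in_itv.
by apply: F_pos; move: cI; rewrite in_itv/= => /andP[ec _]; exact: lt_le_trans ec.
Qed.

Lemma word_nseq n phi P : word h (nseq n phi) P = iter n (Lop h phi) P.
Proof. by elim: n => //= n ->. Qed.

Let nq M : nnms (nseq M (pw 0 1 : R -> \bar R)).
Proof. by apply: nnms_nseq; exact: nnm_pw. Qed.

Let m1 : nnm (cst 1 : R -> \bar R). Proof. exact: nnm_cst. Qed.

Lemma remainingE M : remaining h FE M = word h (nseq M (pw 0 1)) FE.
Proof. by rewrite word_nseq. Qed.

(** The weights g and 1 - g add up to 1, and consistency removes the letter 1 at the end of the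
    word. The second term is thus the mass lost at stick M + 1. *)
Lemma remaining_step M : remaining h FE M.+1 1%R +
  word h (nseq M (pw 0 1)) (Lop h (pw 1 0) FE) 1%R = remaining h FE M 1%R.
Proof.
rewrite (remainingE M) -consistency// /remaining iterSr -word_nseq -wordD//; last 2 first.
- by apply: nnm_Lop => //; exact: nnm_pw.
- by apply: nnm_Lop => //; exact: nnm_pw.
apply: eq_word => // x /andP[x0 _].
rewrite -(LopDl mh x (nnm_pw 0 1) (nnm_pw 1 0) mF).
by apply: eq_Lop => // g gI; rewrite addeC -pwS pw00.
Qed.

Definition cut_le (e : R) (x : R) : \bar R := (\1_(`]-oo, e]) x * F x)%:E.
Definition cut_gt (e : R) (x : R) : \bar R := (\1_(`]e, +oo[) x * F x)%:E.

Let F0 x : (0 <= F x)%R. Proof. by have := mF.2 x; rewrite lee_fin. Qed.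

Let mFR : measurable_fun setT F. Proof. by apply/measurable_EFinP; exact: mF.1. Qed.

Lemma nnm_cut (A : set R) : measurable A -> nnm (fun x => (\1_A x * F x)%:E).
Proof.
move=> mA; apply: nnm_EFin; last by move=> x; rewrite mulr_ge0.
by apply: measurable_funM => //; exact: measurable_indic.
Qed.

Lemma nnm_cut_le e : nnm (cut_le e). Proof. exact: nnm_cut. Qed.
Lemma nnm_cut_gt e : nnm (cut_gt e). Proof. exact: nnm_cut. Qed.

Lemma cutD e x : cut_gt e x + cut_le e x = FE x.
Proof.
rewrite /cut_gt /cut_le -EFinD -mulrDl !indicE !mem_setE !in_itv/= andbT.
by have [_|_] := leP x e; rewrite ?add0r ?addr0 mul1r.
Qed.

(* The factors [1 - g] telescope to the remaining mass, which [cut_le] keeps below [e]. *)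
Lemma word_cut_le e M s : (0 < e)%R -> (0 < s)%R ->
  s%:E * word h (nseq M (pw 0 1)) (cut_le e) s <= e%:E * word h (nseq M (cst 1)) FE s.
Proof.
move=> e0; elim: M s => [|M IH] s s0 /=.
  rewrite /cut_le -!EFinM lee_fin indicE mem_setE in_itv/=.
  have [se|se] := leP s e; last by rewrite mul0r mulr0 mulr_ge0// ltW.
  by rewrite mul1r ler_wpM2r.
have mX : nnm (word h (nseq M (pw 0 1)) (cut_le e)).
  by apply: nnm_word => //; exact: nnm_cut_le.
have mY : nnm (word h (nseq M (cst 1)) FE).
  by apply: nnm_word => //; exact: nnms_nseq.
have e0' : 0 <= e%:E by rewrite lee_fin ltW.
have s0' : 0 <= s%:E by rewrite lee_fin ltW.
have mXi := nnm_Lop_integrand mh s (nnm_pw 0 1) mX.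
have mYi := nnm_Lop_integrand mh s m1 mY.
rewrite /Lop -(integral_nnmZ mu s0' mXi) -(integral_nnmZ mu e0' mYi).
apply: le_integral_nnm.
- by apply: nnmM => //; exact: nnm_cst.
- by apply: nnmM => //; exact: nnm_cst.
move=> g; rewrite /pw.
have [[-> gI]|[-> _]] := indic_I01RP g; last by rewrite !(mul0r, mul0e, mule0).
have [g0 g1] := I01RP gI.
rewrite !mul1r expr1 !mul1e.
have := IH (s * (1 - g))%R; rewrite mulr_gt0// => /(_ isT).
have h0 := mh.2 (g * s)%R.
move: (word _ _ _ _) (word _ _ _ _) (h _) h0 => Y X H H0 XY.
rewrite [leLHS](_ : _ = H * ((s * (1 - g))%:E * X)); last first.
  by rewrite EFinM -!muleA [RHS]muleCA; congr (_ * _); rewrite muleCA.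
rewrite [leRHS]muleCA; exact: lee_wpmul2l.
Qed.

Lemma word_cst1 M : word h (nseq M (cst 1)) FE 1%R = (F 1)%:E.
Proof.
elim: M => // M IH; rewrite -IH -(consistency (nnms_nseq M m1)).
by rewrite !word_nseq iterSr.
Qed.

Lemma word_cut_le1 e M : (0 < e)%R ->
  word h (nseq M (pw 0 1)) (cut_le e) 1%R <= (e * F 1)%:E.
Proof. by move=> e0; have := word_cut_le M e0 ltr01; rewrite mul1e word_cst1 EFinM. Qed.

(** The integral of v^2 r(v) over v < d; it vanishes exactly when almost no pieces are shorter than
    d. *)
Definition small_mass (d : R) : \bar R :=
  \int[mu]_v ((\1_(`]-oo, d[) v)%:E * mon 1 h v).

Let m_small d : nnm (fun v : R => (\1_(`]-oo, d[) v)%:E * mon 1 h v).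
Proof. by apply: nnmM; [exact: nnm_indic | exact: nnm_mon]. Qed.

(** For e < s <= 1, s^2 (L_g F)(s) is the integral of v h(v) F(s - v). On v < e/2 the argument s - v
    stays in [e/2, 1], where F has a positive minimum m, so the integral is at least m times the
    small mass, while F(s) is bounded above. *)
Lemma removal_lower_bound_pos e : (0 < e)%R -> 0 < small_mass (e / 2) ->
  exists2 c : R, (0 < c < 1)%R & forall M,
    c%:E * word h (nseq M (pw 0 1)) (cut_gt e) 1%R <=
    word h (nseq M (pw 0 1)) (Lop h (pw 1 0) FE) 1%R.
Proof.
move=> e0 k0.
(* The small mass is an extended real, possibly infinite; any positive real below it serves. *)
have [k k1 kle] : exists2 k : R, (0 < k)%R & k%:E <= small_mass (e / 2).
  move: k0; case: (small_mass _) => [r r0| _|//].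
    by exists r.
  by exists 1%R => //; rewrite leey.
have e20 : (0 < e / 2)%R by rewrite divr_gt0.
have [m m0 mle] := F_lower_bound e20.
have [N N0 leN] := F_upper_bound e0.
(* Chosen so that c N <= k m; the bound 1/2 keeps c below 1 for the later contraction. *)
pose c := Num.min (1 / 2)%R (k * m / N)%R.
have cle : (c <= k * m / N)%R by rewrite /c ge_min lexx orbT.
have c0 : (0 < c)%R by rewrite /c lt_min divr_gt0//= divr_gt0// mulr_gt0.
have c1 : (c <= 1 / 2)%R by rewrite /c ge_min lexx.
exists c; first by rewrite c0/=; lra.
have c0' : 0 <= c%:E by rewrite lee_fin ltW.
move=> M; rewrite -(wordZ mh 1%R c0' (nq M) (nnm_cut_gt e)).
have mL : nnm (Lop h (pw 1 0) FE) by apply: nnm_Lop => //; exact: nnm_pw.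
apply: le_word => //; first by apply: nnmM; [exact: nnm_cst | exact: nnm_cut_gt].
move=> s /andP[s0 s1]; rewrite /cut_gt indicE mem_setE in_itv/= andbT.
have [es|es] := ltP e s; last by rewrite mul0r mule0; exact: mL.2.
rewrite mul1r.
apply: (@le_trans _ _ (k * m)%:E).
  rewrite -EFinM lee_fin; apply: (@le_trans _ _ (c * N)%R).
    by rewrite ler_pM2l// leN// (ltW es).
  by rewrite -ler_pdivlMr.
apply: (@le_trans _ _ ((s ^+ (1 + 0).+1)%:E * Lop h (pw 1 0) FE s)); last first.
  rewrite -[leRHS]mul1e; apply: lee_wpmul2r; first exact: mL.2.
  by rewrite lee_fin exprn_ile1// ltW.
rewrite (Lop_scale mh lh 1 0 s0 mF lF).
have m0' : 0 <= m%:E by rewrite lee_fin ltW.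
rewrite EFinM muleC.
apply: (@le_trans _ _ (m%:E * small_mass (e / 2))); first exact: lee_wpmul2l.
rewrite /small_mass -(integral_nnmZ mu m0' (m_small _)).
apply: le_integral_nnm.
- by apply: nnmM; [exact: nnm_cst | exact: m_small].
- apply: nnmM; first exact: nnm_mon.
  by apply: nnm_comp; [exact: nnm_mon | exact: measurable_funB].
move=> v; rewrite indicE mem_setE in_itv/=.
have mh0 := (nnm_mon 1 mh lh).2 v.
have mF0 := (nnm_mon 0 mF lF).2 (s - v)%R.
have [v0|v0] := leP v 0%R; first by rewrite left0_mon// !(mul0e, mule0).
have [ve|ve] := ltP v (e / 2)%R; last by rewrite mul0e mule0 mule_ge0.
rewrite mul1e muleC; apply: lee_wpmul2l => //.
rewrite /mon expr0 mul1e lee_fin; apply: mle.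
by apply/andP; split; lra.
Qed.

(** Almost no stick g s is shorter than e/2, and s <= 1, so g >= e/2 almost everywhere for the
    measure that defines L. *)
Lemma removal_lower_bound_zero e : (0 < e < 1)%R -> small_mass (e / 2) = 0 ->
  forall M, (e / 2)%:E * word h (nseq M (pw 0 1)) (cut_gt e) 1%R <=
    word h (nseq M (pw 0 1)) (Lop h (pw 1 0) FE) 1%R.
Proof.
move=> /andP[e0 e1] k0 M.
pose dl := (e / 2)%R.
have d0 : (0 < dl)%R by rewrite divr_gt0.
have d0' : 0 <= dl%:E by rewrite lee_fin ltW.
have mL : nnm (Lop h (pw 1 0) FE) by apply: nnm_Lop => //; exact: nnm_pw.
have mL1 : nnm (Lop h (cst 1) FE) by apply: nnm_Lop.
(* [cut_gt e] is enlarged to F, and consistency rewrites F as L_1 F, which compares with L_g F at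
   each s. *)
apply: (@le_trans _ _ (dl%:E * word h (nseq M (pw 0 1)) (Lop h (cst 1) FE) 1%R)).
  apply: lee_wpmul2l => //; rewrite consistency//.
  apply: le_wordr => //; first exact: nnm_cut_gt.
  by move=> x; rewrite /cut_gt lee_fin -[leRHS]mul1r ler_wpM2r.
rewrite -(wordZ mh 1%R d0' (nq M) mL1).
apply: le_word => //; first by apply: nnmM => //; exact: nnm_cst.
move=> s /andP[s0 s1].
pose th (g : R) : \bar R := (\1_(`]-oo, dl / s[) g)%:E.
have mth : nnm th by exact: nnm_indic.
have Lth0 : Lop h th FE s = 0.
  pose psi (v : R) := (\1_(`]-oo, dl[) v)%:E * h v * FE (s - v)%R.
  have mpsi : nnm psi.
    apply: nnmM; first by apply: nnmM => //; exact: nnm_indic.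
    by apply: (nnm_comp mF); exact: measurable_funB.
  have psi0 : \int[mu]_v psi v = 0.
    (* A nonnegative function of zero integral vanishes almost everywhere; for v > 0 the factor v
       can then be divided out. *)
    have h00 : ae_eq mu setT (fun v : R => (\1_(`]-oo, dl[) v)%:E * mon 1 h v) (cst 0).
      apply/(ae_eq_integral_abs mu measurableT (m_small dl).1).
      rewrite -[RHS]k0; apply: eq_integral => v _.
      by rewrite gee0_abs//; exact: (m_small dl).2.
    transitivity (\int[mu]_(v in [set: R]) (cst 0 v : \bar R)); last exact: integral0.
    apply: ge0_ae_eq_integral => //; [exact: mpsi.1|by move=> v _; exact: mpsi.2|].
    apply: filterS h00 => v /(_ I) hv _.
    have [v0|v0] := leP v 0%R; first by rewrite /psi lh// mule0 mul0e.
    move: hv; rewrite /psi /mon expr1 muleCA => /eqP.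
    by rewrite mule_eq0 eqe gt_eqF//= => /eqP ->; rewrite mul0e.
  apply/eqP; rewrite eq_le; apply/andP; split; last first.
    by apply: (nnm_Lop _ _ _).2.
  apply: (@le_trans _ _ (\int[mu]_g psi (s * g)%R)).
    apply: le_integral_nnm; first exact: (nnm_Lop_integrand mh s mth mF).
      by apply: nnm_comp => //; exact: measurable_funM.
    move=> g; rewrite /psi /th.
    have -> : (s - s * g = s * (1 - g))%R by ring.
    have h0 := mh.2 (s * g)%R; have F0' := mF.2 (s * (1 - g))%R.
    rewrite [(g * s)%R]mulrC !indicE !mem_setE !in_itv/= ltr_pdivlMr// [(g * s)%R]mulrC.
    apply: lee_wpmul2r => //; case: ltP => _; last by rewrite !mul0e.
    rewrite !mul1e -[leRHS]mul1e; apply: lee_wpmul2r => //.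
    by rewrite lee_fin lern1 leq_b1.
  have := integral_scale s0 mpsi; rewrite psi0 => /eqP.
  by rewrite mule_eq0 eqe gt_eqF//= => /eqP ->.
have mpd : nnm (fun g => dl%:E * th g) by apply: nnmM => //; exact: nnm_cst.
(* Adding the null term makes dl <= g + dl th(g) true for every g in (0, 1), so the comparison is
   pointwise. *)
have <- : Lop h (fun g => pw 1 0 g + dl%:E * th g) FE s = Lop h (pw 1 0) FE s.
  by rewrite (LopDl mh s (nnm_pw 1 0) mpd mF) (LopZl mh s d0' mth mF) Lth0 mule0 adde0.
rewrite -(LopZl mh s d0' m1 mF).
apply: le_Lop => //.
- by apply: nnmM => //; exact: nnm_cst.
- by apply: nnmD => //; exact: nnm_pw.
move=> g gI; have [g0 g1] := I01RP gI.
rewrite /pw /th mule1 -EFinM -EFinD lee_fin.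
have [[-> _]|[_ //]] := indic_I01RP g.
rewrite expr1 expr0 mulr1 mul1r indicE mem_setE in_itv/= ltr_pdivlMr//.
case: ltP => gs; first by rewrite mulr1 lerDr ltW.
by rewrite mulr0 addr0 (le_trans gs)// ler_piMr// ltW.
Qed.

Lemma removal_lower_bound e : (0 < e < 1)%R ->
  exists2 c : R, (0 < c < 1)%R & forall M,
    c%:E * word h (nseq M (pw 0 1)) (cut_gt e) 1%R <=
    word h (nseq M (pw 0 1)) (Lop h (pw 1 0) FE) 1%R.
Proof.
move=> /andP[e0 e1].
have k0 : 0 <= small_mass (e / 2) by apply: integral_nnm_ge0; exact: m_small.
have [kz|kz] := eqVneq (small_mass (e / 2)) 0.
  exists (e / 2)%R; first by apply/andP; split; lra.
  by apply: removal_lower_bound_zero => //; rewrite e0.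
by apply: removal_lower_bound_pos => //; rewrite lt0e kz k0.
Qed.

Lemma remaining_le M : remaining h FE M 1%R <= (F 1)%:E.
Proof.
elim: M => // M IH; apply: le_trans IH; rewrite -(remaining_step M) leeDl//.
by apply: (nnm_word mh (nq M) _).2; apply: nnm_Lop => //; exact: nnm_pw.
Qed.

(** A contraction up to a small constant: b(M+1) <= (1 - c) b(M) + c ep F(1), hence b(M) <= ep F(1)
    + (1 - c)^M F(1). *)
Lemma remaining_small e : (0 < e)%R -> exists M, remaining h FE M 1%R <= e%:E.
Proof.
move=> e0; have F1 := F_pos ltr01.
(* Half of e pays for the constant ep F(1), the other half for the geometric term. *)
pose ep := Num.min (1 / 2)%R (e / (2 * F 1))%R.
have ep0 : (0 < ep)%R by rewrite lt_min divr_gt0//= divr_gt0// mulr_gt0.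
have ep1 : (ep < 1)%R by rewrite gt_min; apply/orP; left; lra.
have epe : (ep * F 1 <= e / 2)%R.
  have : (ep <= e / (2 * F 1))%R by rewrite ge_min lexx orbT.
  by rewrite ler_pdivlMr ?mulr_gt0//; lra.
have [c /andP[c0 c1] hc] := removal_lower_bound (introT andP (conj ep0 ep1)).
pose b M := fine (remaining h FE M 1%R).
have bE M : remaining h FE M 1%R = (b M)%:E.
  rewrite fineK// ge0_fin_numE; last exact: (nnm_remaining mh mF M).2.
  by apply: le_lt_trans (remaining_le M) _; rewrite ltry.
(* At most ep F(1) of b(M) comes from remaining masses below ep; of the rest a proportion at least c
   is lost. *)
have step M : (b M.+1 <= (1 - c) * b M + c * (ep * F 1))%R.
  have := remaining_step M; have := hc M; have := word_cut_le1 M ep0.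
  have : word h (nseq M (pw 0 1)) (cut_gt ep) 1%R +
         word h (nseq M (pw 0 1)) (cut_le ep) 1%R = (b M)%:E.
    rewrite -bE remainingE.
    rewrite -(wordD mh 1%R (nq M) (nnm_cut_gt ep) (nnm_cut_le ep)).
    by congr word; apply/funext => x; exact: cutD.
  rewrite !bE.
  have := (nnm_word mh (nq M) (nnm_cut_gt ep)).2 1%R.
  have := (nnm_word mh (nq M) (nnm_cut_le ep)).2 1%R.
  case: (word _ _ (cut_le ep) _) => // u u0; case: (word _ _ (cut_gt ep) _) => // v v0.
  case: (word _ _ (Lop _ _ _) _) => // w.
  rewrite -!EFinM !lee_fin -!EFinD => -[uv] ule wle [bw].
  nra.
have bnd M : (b M <= ep * F 1 + (1 - c) ^+ M * F 1)%R.
  elim: M => [|M IH].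
    have : (b 0%N <= F 1)%R by rewrite -lee_fin -bE; exact: remaining_le.
    by rewrite expr0 mul1r => b0; apply: (le_trans b0); rewrite lerDr mulr_ge0 ?ltW.
  apply: (le_trans (step M)); rewrite exprS.
  have c1' : (0 <= 1 - c)%R by lra.
  have := ler_wpM2l c1' IH; rewrite mulrDr => IH'.
  apply: (@le_trans _ _ ((1 - c) * (ep * F 1) + (1 - c) * (1 - c) ^+ M * F 1 + c * (ep * F 1))%R).
    by rewrite lerD2r; apply: (le_trans IH'); rewrite !mulrA.
  by rewrite le_eqVlt; apply/orP; left; apply/eqP; ring.
have : (fun M => (1 - c) ^+ M : R)%R @ \oo --> (0 : R)%R.
  by apply: cvg_expr; rewrite ger0_norm; lra.
move=> /cvgrPdist_lt /(_ (e / (2 * F 1))%R); rewrite divr_gt0 ?mulr_gt0// => /(_ isT).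
move=> [M _ /(_ M (leqnn _))]; rewrite /= sub0r normrN ger0_norm; last first.
  by rewrite exprn_ge0//; lra.
rewrite ltr_pdivlMr ?mulr_gt0// => hM; exists M; rewrite bE lee_fin.
by have := bnd M; lra.
Qed.

End remaining_mass.

(** * Occupation of the first labels *)

Section occupation_mass.
Context {R : realType}.

(* Occupation probabilities for the first [M] labels, given the stick fractions [g]. *)
Fixpoint occ_mass (M : nat) (l : seq nat) (g : nat -> R) : \bar R :=
  if M is M'.+1 then
    pw 0 (wt l) (g 0%N) * occ_mass M' l (fun j => g j.+1) +
    \sum_(p <- picks l)
      pw p.1.+1 (wt p.2) (g 0%N) * occ_mass M' p.2 (fun j => g j.+1)
  else (nilp l)%:R%:E.

Context {d : measure_display} {Omega : measurableType d}.
Variables (Pr : probability Omega R) (G : nat -> Omega -> R).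
Hypothesis mG : forall j, measurable_fun setT (G j).

Lemma nnm_occ_mass M l k : nnm (fun w => occ_mass M l (fun j => G (k + j)%N w)).
Proof.
elim: M l k => [|M IH] l k /=; first by apply: nnm_cst; rewrite lee_fin.
have IH' l' : nnm (fun w => occ_mass M l' (fun j => G (k + j.+1)%N w)).
  have := IH l' k.+1; congr nnm; apply/funext => w; congr occ_mass.
  by apply/funext => j; rewrite addnS.
have mpw a b : nnm (fun w => pw a b (G (k + 0)%N w)).
  by apply: nnm_comp (mG _); exact: nnm_pw.
by apply: nnmD; [exact: nnmM | apply: nnm_sum => p; exact: nnmM].
Qed.

Variables h F : R -> \bar R.
Hypotheses (mh : nnm h) (mF : nnm F).
Hypothesis HE : forall phis, nnms phis ->
  F 1%R * \int[Pr]_w prodseq phis (G ^~ w) = word h phis F 1%R.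

(** The letters [phis] stand for the sticks already spent: unfolding [occ_mass] once appends one
    letter, exactly as [word_occ] does. *)
Lemma expectation_occ_mass M l phis : nnms phis ->
  F 1%R * \int[Pr]_w (prodseq phis (G ^~ w) *
    occ_mass M l (fun j => G (size phis + j)%N w)) =
  word h phis (iter M (occ h) (only_nil F) l) 1%R.
Proof.
elim: M l phis => [|M IH] l phis mphis.
  case: l => [|a l] /=.
    rewrite -HE//; congr (_ * _); apply: eq_integral => w _.
    by rewrite mule1.
  have -> : (cst 0 : R -> \bar R) = (fun x => 0 * F x).
    by apply/funext => x; rewrite mul0e.
  rewrite wordZ// mul0e integral0_eq ?mule0// => w _.
  by rewrite mule0.
have F1 : 0 <= F 1%R by exact: mF.2.
have mpw a b : nnms (rcons phis (pw a b)) by apply: nnms_rcons => //; exact: nnm_pw.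
have mO a b l' : nnm (fun w => prodseq (rcons phis (pw a b)) (G ^~ w) *
    occ_mass M l' (fun j => G (size (rcons phis (pw a b : R -> \bar R)) + j)%N w)).
  by apply: nnmM; [exact: nnm_prodseq | exact: nnm_occ_mass].
rewrite [iter _ _ _ _]/= word_occ//; last by apply: nnm_iter_occ => //; exact: nnm_only_nil.
rewrite -IH//.
transitivity (F 1%R * (
  \int[Pr]_w (prodseq (rcons phis (pw 0 (wt l))) (G ^~ w) *
    occ_mass M l (fun j => G (size (rcons phis (pw 0 (wt l) : R -> \bar R)) + j)%N w)) +
  \sum_(p <- picks l)
   \int[Pr]_w (prodseq (rcons phis (pw p.1.+1 (wt p.2))) (G ^~ w) *
    occ_mass M p.2 (fun j => G (size (rcons phis (pw p.1.+1 (wt p.2) : R -> \bar R)) + j)%N w)))); last first.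
  rewrite ge0_muleDr; last 2 first.
  - by apply: integral_nnm_ge0; exact: mO.
  - by apply: sume_ge0 => p _; apply: integral_nnm_ge0; exact: mO.
  congr (_ + _); rewrite ge0_sume_distrr; last first.
    by move=> p _; apply: integral_nnm_ge0; exact: mO.
  by apply: eq_bigr => p _; rewrite IH.
congr (_ * _); rewrite -integral_nnm_sum; last by move=> p; exact: mO.
rewrite -integral_nnmD; [|exact: mO|by apply: nnm_sum => p; exact: mO].
apply: eq_integral => w _; rewrite [occ_mass M.+1 _ _]/= addn0.
have sz a b : (fun j => G (size (rcons phis (pw a b : R -> \bar R)) + j)%N w) =
    (fun j => G (size phis + j.+1)%N w).
  by apply/funext => j; rewrite size_rcons addSnnS.
have x0 := (nnm_prodseq mG mphis).2 w.
have O0 l' : 0 <= occ_mass M l' (fun j => G (size phis + j.+1)%N w).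
  by rewrite -(sz 0%N 0%N); exact: (nnm_occ_mass M l' _).2.
have pw0 a b x : 0 <= (pw a b x : \bar R) by exact: (nnm_pw a b).2.
rewrite ge0_muleDr; [|by apply: mule_ge0|by apply: sume_ge0 => p _; apply: mule_ge0].
congr (_ + _).
  by rewrite sz prodseq_rcons -muleA.
rewrite ge0_sume_distrr; last by move=> p _; apply: mule_ge0.
apply: eq_bigr => p _.
by rewrite sz prodseq_rcons -muleA.
Qed.

End occupation_mass.

(** * Convergence of the occupation probabilities to W *)

Section occupation_limit.
Context {R : realType}.
Variables (h : R -> \bar R) (F : R -> R).
Local Notation FE := (fun x => (F x)%:E).
Hypotheses (mh : nnm h) (lh : left0 h) (mF : nnm FE) (lF : left0 FE).
Hypothesis F_pos : forall x : R, (0 < x)%R -> (0 < F x)%R.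
Hypothesis F_cont : {in posR, continuous F}.
Hypothesis consistency : forall phis, nnms phis ->
  word h phis (Lop h (cst 1) FE) 1%R = word h phis FE 1%R.

Lemma iter_occ_only_nil_le M l :
  iter M (occ h) (only_nil FE) l 1%R <= What h FE l 1%R.
Proof.
rewrite [leRHS](What_iter_occ mh lh mF lF consistency M l (phis := [::]) I).
rewrite /word/= (iter_occ_split mh mF) leeDl//.
by apply: (nnm_iter_occ mh (nnm_off_nil mh mF) M l).2.
Qed.

Lemma What_le_iter_occ_only_nil l (e : R) : (0 < e)%R ->
  exists M, What h FE l 1%R <= iter M (occ h) (only_nil FE) l 1%R + e%:E.
Proof.
move=> e0.
have k0 : (0 < (size l).+1%:R :> R)%R by [].
have [M hM] := remaining_small mh lh mF lF F_pos F_cont consistency (divr_gt0 e0 k0).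
exists M.
rewrite [leLHS](What_iter_occ mh lh mF lF consistency M l (phis := [::]) I).
rewrite /word/= (iter_occ_split mh mF); apply: leeD => //.
apply: (le_trans (off_nil_le mh mF consistency M l (phis := [::]) I)).
rewrite /word/=.
apply: (@le_trans _ _ ((size l).+1%:R%:E * (e / (size l).+1%:R)%:E)).
  apply: lee_pmul => //; first by exact: (nnm_remaining mh mF M).2.
  by rewrite lee_fin ler_nat.
by rewrite -EFinM mulrC divfK// gt_eqF.
Qed.

End occupation_limit.

(** * Sums over distinct labels *)

Section distinct_labels.
Context {R : realType}.
Local Open Scope ring_scope.
Implicit Types (P : nat -> R) (u l : seq nat).

(** Given the frequencies P, the probability that the blocks carry distinct labels below M; [u]
    lists the labels already used. *)
Fixpoint distinct_sum (M : nat) P u l : R :=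
  if l is a :: l' then
    \sum_(i < M) (if (i : nat) \in u then 0
                  else P i ^+ a.+1 * distinct_sum M P ((i : nat) :: u) l')
  else 1.

Lemma distinct_sum_used M P u u' l : 0%N \in u' ->
  (forall i, (i.+1 \in u') = (i \in u)) ->
  distinct_sum M.+1 P u' l = distinct_sum M (fun i => P i.+1) u l.
Proof.
elim: l u u' => //= a l IH u u' u0 uu'.
rewrite big_ord_recl u0 add0r; apply: eq_bigr => i _.
rewrite lift0 uu'; case: ifP => // _; congr (_ * _); apply: IH.
  by rewrite in_cons u0 orbT.
by move=> j; rewrite !in_cons uu' eqSS.
Qed.

(** Label 0 goes to no block or to exactly one. The used labels are compared through membership
    only, so that the same shift covers lists that do contain 0, as in [distinct_sum_used]. *)
Lemma distinct_sumS M P u u' l : 0%N \notin u' ->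
  (forall i, (i.+1 \in u') = (i \in u)) ->
  distinct_sum M.+1 P u' l = distinct_sum M (fun i => P i.+1) u l +
    \sum_(p <- picks l) P 0%N ^+ p.1.+1 * distinct_sum M (fun i => P i.+1) u p.2.
Proof.
elim: l u u' => [|a l IH] u u' u0 uu' /=; first by rewrite big_nil addr0.
rewrite big_ord_recl (negbTE u0) big_cons big_map.
have -> : distinct_sum M.+1 P (((ord0 : 'I_M.+1) : nat) :: u') l =
    distinct_sum M (fun i => P i.+1) u l.
  apply: distinct_sum_used; first by rewrite mem_head.
  by move=> i; rewrite in_cons uu'.
rewrite [RHS]addrCA; congr (_ + _).
under [X in _ + X]eq_bigr do rewrite mulr_sumr.
rewrite exchange_big -big_split/=; apply: eq_bigr => i _.
rewrite -[bump 0 i]/(i.+1) uu'; case: ifP => iu.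
  by rewrite big1 ?addr0// => p _; rewrite mulr0.
rewrite (IH ((i : nat) :: u) (i.+1 :: u')); last 2 first.
- by rewrite in_cons negb_or u0.
- by move=> j; rewrite !in_cons uu' eqSS.
rewrite mulrDr; congr (_ + _); rewrite mulr_sumr.
by apply: eq_bigr => p _; rewrite mulrCA.
Qed.

Lemma distinct_sumZ M (c : R) P u l :
  distinct_sum M (fun i => c * P i) u l = c ^+ wt l * distinct_sum M P u l.
Proof.
elim: l u => [|a l IH] u /=; first by rewrite mulr1.
rewrite mulr_sumr; apply: eq_bigr => i _; case: ifP => _; first by rewrite mulr0.
by rewrite IH exprMn wt_cons -addSn exprD; ring.
Qed.

Lemma distinct_sum_ge0 M P u l : (forall i, 0 <= P i) -> 0 <= distinct_sum M P u l.
Proof.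
move=> P0; elim: l u => //= a l IH u; apply: sumr_ge0 => i _.
by case: ifP => // _; rewrite mulr_ge0// exprn_ge0.
Qed.

Lemma le_distinct_sumS M P u l : (forall i, 0 <= P i) ->
  distinct_sum M P u l <= distinct_sum M.+1 P u l.
Proof.
move=> P0; elim: l u => //= a l IH u; rewrite big_ord_recr/= -[leLHS]addr0.
apply: lerD; last first.
  by case: ifP => // _; rewrite mulr_ge0 ?exprn_ge0 ?distinct_sum_ge0.
apply: ler_sum => i _; case: ifP => // _.
by rewrite ler_wpM2l ?exprn_ge0.
Qed.

Definition stick (g : nat -> R) (j : nat) : R := g j * \prod_(i < j) (1 - g i).

Lemma stickS g j : stick g j.+1 = (1 - g 0%N) * stick (fun i => g i.+1) j.
Proof. by rewrite /stick big_ord_recl mulrCA. Qed.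

(** Beyond the first stick, the sticks are 1 - g_0 times those of the shifted sequence. Homogeneity
    ([distinct_sumZ]) extracts the power of 1 - g_0 that [pw] carries, and [distinct_sumS] matches
    the recursion. *)
Lemma occ_massE M l (g : nat -> R) : (forall j, I01R (g j)) ->
  occ_mass M l g = (distinct_sum M (stick g) [::] l)%:E.
Proof.
elim: M l g => [|M IH] l g gI /=.
  by case: l => //= a l; rewrite big_ord0.
rewrite (@distinct_sumS M (stick g) [::] [::] l)//.
have -> : (fun i => stick g i.+1) = (fun i => (1 - g 0%N) * stick (fun j => g j.+1) i).
  by apply/funext => i; exact: stickS.
have pwE a b : pw a b (g 0%N) = (g 0%N ^+ a * (1 - g 0%N) ^+ b)%:E.
  by rewrite /pw; have [[-> _]|[_ ]] := indic_I01RP (g 0%N); [rewrite mul1r|].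
rewrite distinct_sumZ EFinD pwE expr0 mul1r IH// -sumEFin; congr (_ + _)%E.
apply: eq_bigr => p _; rewrite pwE IH// distinct_sumZ.
by rewrite /stick big_ord0 mulr1 -EFinM mulrA.
Qed.

Lemma distinct_sum_tuple M P u l k : size l = k ->
  distinct_sum M P u l =
  \sum_(y : k.-tuple 'I_M | uniq y && all (fun i : 'I_M => (i : nat) \notin u) y)
    \prod_(i < k) P (tnth y i) ^+ (nth 0%N l i).+1.
Proof.
elim: l k u => [|a l IH] k u <-.
  rewrite (big_pred1 [tuple]); first by rewrite big_ord0.
  by move=> y; rewrite tuple0/=; apply/esym/eqP.
rewrite (reindex (fun p : 'I_M * (size l).-tuple 'I_M => cons_tuple p.1 p.2)); last first.
  exists (fun t => (thead t, behead_tuple t)) => [[i y] _|t _] /=.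
    by rewrite theadE; congr pair; apply: val_inj.
  by rewrite [RHS]tuple_eta; apply: val_inj.
rewrite -(pair_big_dep xpredT
  (fun (i : 'I_M) (y : (size l).-tuple 'I_M) =>
     uniq (i :: y) && all (fun j : 'I_M => (j : nat) \notin u) (i :: y))
  (fun i y => \prod_(j < (size l).+1)
     P (tnth (cons_tuple i y) j) ^+ (nth 0%N (a :: l) j).+1))/=.
apply: eq_bigr => i _.
case: ifP => iu.
  by rewrite big_pred0// => y; rewrite andbF.
rewrite (IH (size l))// mulr_sumr; apply: eq_big.
  move=> y; rewrite -andbA andbCA; congr (_ && _).
  rewrite -has_pred1 -all_predC -all_predI; apply: eq_all => j /=.
  by rewrite in_cons negb_or -val_eqE.
move=> y _; rewrite big_ord_recl tnth0/=; congr (_ * _).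
by apply: eq_bigr => j _; rewrite tnthS.
Qed.

End distinct_labels.

(** * Labellings that induce a given partition *)

Section labelings.
Context {R : realType}.
Local Open Scope ring_scope.
Variables (n : nat) (pi : {set {set 'I_n}}).
Hypotheses (n_pos : (0 < n)%N) (Hpi : finset.partition pi [set: 'I_n]%SET).

Definition inducesb M (x : {ffun 'I_n -> 'I_M}) : bool :=
  [forall m : 'I_n, forall m' : 'I_n,
    (x m == x m') == (finset.pblock pi m == finset.pblock pi m')].

Let m0 : 'I_n := Ordinal n_pos.

Let block_in m : finset.pblock pi m \in pi.
Proof. by rewrite pblock_mem// (cover_partition Hpi) finset.in_setT. Qed.

Let mem_block m : m \in finset.pblock pi m.
Proof. by rewrite mem_pblock (cover_partition Hpi) finset.in_setT. Qed.

Let blk (m : 'I_n) : 'I_#|pi| := enum_rank_in (block_in m0) (finset.pblock pi m).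

Let blkK m : enum_val (blk m) = finset.pblock pi m.
Proof. by rewrite enum_rankK_in. Qed.

Let rep (j : 'I_#|pi|) : 'I_n := odflt m0 [pick m in (enum_val j : {set 'I_n})].

Let triv : finset.trivIset pi. Proof. by case/and3P: Hpi. Qed.

Let pblock_rep j : finset.pblock pi (rep j) = enum_val j.
Proof.
rewrite /rep; case: pickP => [m mj|/= emp]; first exact: def_pblock (enum_valP j) mj.
have := enum_valP j; have -> : enum_val j = finset.set0.
  by apply/setP => m; rewrite emp finset.in_set0.
by case/and3P: Hpi => _ _ /negP.
Qed.

Let repK j : blk (rep j) = j.
Proof. by apply: enum_val_inj; rewrite blkK pblock_rep. Qed.

(** A labelling that induces [pi] is the same as an injective choice of one label per block: [f]
    spreads the labels over the blocks, [g] reads them at representatives. *)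
Lemma distinct_sum_labelings M (P : nat -> R) :
  distinct_sum M P [::] [seq #|A : {set 'I_n}|.-1 | A <- enum pi] =
  \sum_(x : {ffun 'I_n -> 'I_M} | inducesb x) \prod_(m < n) P (x m).
Proof.
rewrite (@distinct_sum_tuple R M P [::] _ #|pi|); last by rewrite size_map -cardE.
pose f (y : #|pi|.-tuple 'I_M) : {ffun 'I_n -> 'I_M} := [ffun m => tnth y (blk m)].
pose g (x : {ffun 'I_n -> 'I_M}) : #|pi|.-tuple 'I_M := [tuple x (rep j) | j < #|pi|].
have gK x : inducesb x -> f (g x) = x.
  move=> /forallP ix; apply/ffunP => m; rewrite ffunE tnth_mktuple.
  have /forallP /(_ m) := ix (rep (blk m)).
  by rewrite pblock_rep blkK eqxx eqb_id => /eqP.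
rewrite (reindex_onto f g)//; apply: eq_big => y.
  rewrite -[RHS]andbC; apply/andP/andP.
    move=> [/tuple_uniqP inj _]; split.
      apply/eqP/eq_from_tnth => j.
      by rewrite tnth_mktuple ffunE repK.
    apply/forallP => m; apply/forallP => m'; rewrite !ffunE; apply/eqP.
    rewrite (inj_eq inj) -blkK -[finset.pblock pi m']blkK.
    by rewrite (inj_eq enum_val_inj).
  move=> [/eqP gfy /forallP ind]; split; last by apply/allP.
  apply/tuple_uniqP => j j'.
  rewrite -gfy !tnth_mktuple => /eqP.
  have /forallP /(_ (rep j')) /eqP -> := ind (rep j).
  by rewrite !pblock_rep (inj_eq enum_val_inj) => /eqP.
move=> _; rewrite [RHS](partition_big blk predT)//=; apply: eq_bigr => j _.
rewrite (eq_bigr (fun _ => P (tnth y j))); last by move=> m /eqP <-; rewrite ffunE.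
rewrite prodr_const (nth_map finset.set0); last by rewrite -cardE.
rewrite -enum_val_nth; congr (_ ^+ _).
have -> : #|[pred m | blk m == j]| = #|enum_val j|.
  apply: eq_card => m; rewrite [LHS]unfold_in/=.
  apply/eqP/idP => [<-|mj]; first by rewrite blkK mem_block.
  by apply: enum_val_inj; rewrite blkK; exact: def_pblock (enum_valP j) mj.
rewrite prednK// card_gt0; apply/eqP => e0.
have := enum_valP j; rewrite e0.
by case/and3P: Hpi => _ _ /negP.
Qed.

End labelings.

(** * The series over all labellings as a limit over bounded labels *)

Section label_series.
Context {R : realType}.

Lemma ler_sum_subseq {T : eqType} (s t : seq T) (F : T -> R) :
  uniq s -> uniq t -> {subset s <= t} -> (forall x, (0 <= F x)%R) ->
  (\sum_(x <- s) F x <= \sum_(x <- t) F x)%R.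
Proof.
move=> us ut st F0.
have -> : (\sum_(x <- s) F x = \sum_(x <- t | x \in s) F x)%R.
  rewrite -[RHS]big_filter; apply: perm_big; apply: uniq_perm; [by []|exact: filter_uniq|].
  move=> x; rewrite mem_filter; case xs : (x \in s) => //=.
  by apply/esym; exact: st.
by rewrite big_mkcond/=; apply: ler_sum => x _; case: ifP.
Qed.

(** A countable type has countably many finite subsets, so the supremum over finite subsets of S is
    one over a sequence: [e k] is the k-th finite set cut down to S, and empty when k is not a
    code. *)
Lemma measurable_esum {d} {Omega : measurableType d} (T : countType)
  (S : set T) (a : T -> Omega -> \bar R) :
  (forall x, measurable_fun setT (a x)) ->
  measurable_fun setT (fun w => \esum_(x in S) a x w).
Proof.
move=> ma.
pose e (k : nat) : seq T := if (choice.unpickle k : option {fset T}) is Some X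
  then [seq x <- (X : seq T) | x \in S] else [::].
have eE w : \esum_(x in S) a x w = esups (fun k => \sum_(x <- e k) a x w) 0%N.
  rewrite /esum /esups /sdrop; congr ereal_sup; apply/seteqP; split.
    move=> _ [A [fA AS] <-] /=.
    exists (choice.pickle (fset_set A)) => //; rewrite /e choice.pickleK fsbig_finite//=.
    congr bigop; apply/all_filterP/allP => x.
    by move=> xA; have := xA : x \in fset_set A; rewrite in_fset_set// => /set_mem/AS/mem_set.
  move=> _ [k _ <-] /=.
  exists [set` e k]; last first.
    rewrite -fsbig_seq//; rewrite /e; case: choice.unpickle => // X.
    by apply: filter_uniq; exact: fset_uniq.
  split; first exact: finite_seq.
  rewrite /e; case: choice.unpickle => [X|] x //=.
  by rewrite mem_filter => /andP[/set_mem].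
have -> : (fun w => \esum_(x in S) a x w) =
    (fun w => esups (fun k => \sum_(x <- e k) a x w) 0%N) by apply/funext.
apply: (measurable_fun_esups (f := fun k w => \sum_(x <- e k) a x w)) => k.
exact: emeasurable_sum.
Qed.

Variables (n : nat) (pi : {set {set 'I_n}}).
Hypotheses (n_pos : (0 < n)%N) (Hpi : finset.partition pi [set: 'I_n]%SET).

Let emb M (x : {ffun 'I_n -> 'I_M}) : {ffun 'I_n -> nat} := [ffun m => (x m : nat)].

Let emb_inj M : injective (@emb M).
Proof.
move=> x y /ffunP xy; apply/ffunP => m; apply: val_inj.
by have := xy m; rewrite !ffunE.
Qed.

Let labs M := [seq emb x | x <- enum {: {ffun 'I_n -> 'I_M}} & inducesb pi x].

Let uniq_labs M : uniq (labs M).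
Proof. by rewrite (map_inj_uniq (@emb_inj M)); apply: filter_uniq; exact: enum_uniq. Qed.

Let inducesbP M (x : {ffun 'I_n -> 'I_M}) : induces pi (emb x) <-> inducesb pi x.
Proof.
split => [ix|/forallP ix m m'].
  apply/forallP => m; apply/forallP => m'; apply/eqP.
  by have := ix m m'; rewrite !ffunE.
by have /forallP /(_ m') /eqP := ix m; rewrite !ffunE.
Qed.

Let labsP M (x : {ffun 'I_n -> nat}) :
  x \in labs M <-> induces pi x /\ forall m, (x m < M)%N.
Proof.
split.
  move=> /mapP[y]; rewrite mem_filter => /andP[iy _] ->; split; first exact/inducesbP.
  by move=> m; rewrite ffunE.
move=> [ix xM]; pose y : {ffun 'I_n -> 'I_M} := [ffun m => Ordinal (xM m)].
have xy : x = emb y by apply/ffunP => m; rewrite !ffunE.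
apply/mapP; exists y => //; rewrite mem_filter mem_enum andbT.
by apply/inducesbP; rewrite -xy.
Qed.

Lemma esum_labelings (p : nat -> R) : (forall i, (0 <= p i)%R) ->
  \esum_(x in [set x : {ffun 'I_n -> nat} | induces pi x]) (\prod_(m < n) p (x m))%:E =
  limn (fun M => (distinct_sum M p [::]
    [seq #|A : {set 'I_n}|.-1 | A <- enum pi])%:E).
Proof.
move=> p0; set l := [seq _ | _ <- _].
pose F (x : {ffun 'I_n -> nat}) := (\prod_(m < n) p (x m))%R.
have F0 x : (0 <= F x)%R by apply: prodr_ge0.
have dE M : distinct_sum M p [::] l = (\sum_(x <- labs M) F x)%R.
  rewrite (distinct_sum_labelings n_pos Hpi) big_map big_filter big_enum_cond/=.
  by apply: eq_bigr => x _; apply: eq_bigr => m _; rewrite ffunE.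
have nd : {homo (fun M => (distinct_sum M p [::] l)%:E) : u v / (u <= v)%N >-> u <= v}.
  by apply: homo_leq => // [x y z|M]; [exact: le_trans | rewrite lee_fin le_distinct_sumS].
rewrite (cvg_lim _ (ereal_nondecreasing_cvgn nd))//.
apply/eqP; rewrite eq_le; apply/andP; split.
  apply: ge_ereal_sup => _ [A [fA AS] <-].
  rewrite fsbig_finite//= sumEFin.
  pose t := (fset_set A : seq {ffun 'I_n -> nat}).
  (* Above every label used by the finite set A, so A lies among the labellings with labels below
     M. *)
  pose M := (\max_(x <- t) \max_(m < n) x m).+1.
  apply: (@le_trans _ _ (distinct_sum M p [::] l)%:E); last first.
    by apply: ereal_sup_ubound; exists M.
  rewrite lee_fin dE; apply: ler_sum_subseq => //; first exact: fset_uniq.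
  move=> x xt; apply/labsP; split.
    have := xt : x \in fset_set A; rewrite in_fset_set// => /set_mem; exact: AS.
  move=> m; rewrite ltnS (big_rem x xt)/=.
  by rewrite leq_max (leq_bigmax m).
apply: ge_ereal_sup => _ [M _ <-].
rewrite dE; apply: ereal_sup_ubound; exists [set` labs M].
  split; first exact: finite_seq.
  by move=> x /= /labsP[].
by rewrite -fsbig_seq// sumEFin.
Qed.

End label_series.

(** * Simplex integrals *)

Section simplex_integral.
Context {R : realType}.
Local Notation mu := (@lebesgue_measure R).

(** The singleton is a separate case because convolution has no unit among functions; the value at
    the empty list is a default. *)
Fixpoint conv_list (h : R -> \bar R) (l : seq nat) : R -> \bar R :=
  if l is a :: l' then
    if l' is [::] then mon a h else conv (mon a h) (conv_list h l')
  else cst 0.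

Lemma left0_conv (a b : R -> \bar R) : left0 a -> left0 b -> left0 (conv a b).
Proof.
move=> la lb x x0; apply: integral0_eq => v _.
have [v0|v0] := leP v 0%R; first by rewrite la ?mul0e.
by rewrite lb ?mule0// subr_le0 (le_trans x0)// ltW.
Qed.

Lemma conv_list_cons h a b l :
  conv_list h (a :: b :: l) = conv (mon a h) (conv_list h (b :: l)).
Proof. by []. Qed.

Section conv_list_theory.
Variable h : R -> \bar R.
Hypotheses (mh : nnm h) (lh : left0 h).

Lemma nnm_conv_list l : nnm (conv_list h l).
Proof.
elim: l => [|a [|b l] IH]; first exact: nnm_cst.
  exact: nnm_mon.
by rewrite conv_list_cons; apply: nnm_conv => //; exact: nnm_mon.
Qed.

Lemma left0_conv_list l : left0 (conv_list h l).
Proof.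
elim: l => [|a [|b l] IH]; [by [] | exact: left0_mon |].
by rewrite conv_list_cons; apply: left0_conv => //; exact: left0_mon.
Qed.

(** Each layer of [What], cleared of denominators by [Lop_scale], is one more convolution;
    associativity collects the block factors in front of F. *)
Lemma mon_What F l : nnm F -> left0 F -> l != [::] ->
  mon (wt l) (What h F l) = conv (conv_list h l) F.
Proof.
move=> mF lF; elim: l => // a l IH _.
have step : mon (wt (a :: l)) (What h F (a :: l)) =
    conv (mon a h) (mon (wt l) (What h F l)).
  apply/funext => s; have [s0|s0] := leP s 0%R.
    rewrite left0_mon//; last exact: left0_What.
    apply/esym/left0_conv => //; first exact: left0_mon.
    by apply: left0_mon; exact: left0_What.
  rewrite /mon wt_cons What_cons.
  exact: (Lop_scale mh lh a (wt l) s0 (nnm_What mh mF l) (left0_What lh lF l)).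
case: l => [|b l] in IH step *.
  rewrite step; apply/funext => s; apply: eq_integral => v _.
  by congr (_ * _); rewrite /mon expr0 mul1e.
rewrite step IH// conv_list_cons; apply/funext => s.
by rewrite conv_assoc//; [exact: nnm_mon | exact: nnm_conv_list].
Qed.

End conv_list_theory.

Variables (rho : R -> R) (t : R).
Hypotheses (rho_meas : measurable_fun posR rho)
  (rho_ge0 : forall x : R, (0 < x)%R -> (0 <= rho x)%R) (t0 : (0 < t)%R).

(* The weight [x rho(x)] after rescaling the total mass [t] to [1]. *)
Definition levy_weight (x : R) : \bar R :=
  (if (0 < x)%R then x * (t * rho (t * x)) else 0)%R%:E.

Lemma left0_levy_weight : left0 levy_weight.
Proof. by move=> x x0; rewrite /levy_weight ltNge x0. Qed.

Lemma measurable_posR_scale (f : R -> R) : measurable_fun posR f ->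
  measurable_fun setT (fun x : R => if (0 < x)%R then f (t * x)%R else 0%R).
Proof.
move=> mf.
have mp : measurable (posR : set R) by exact: measurable_itv.
have mf0 : measurable_fun setT (f \_ posR) by apply/(measurable_restrictT f mp).
have -> : (fun x : R => if (0 < x)%R then f (t * x)%R else 0%R) =
    (fun x => (f \_ posR) (t * x)%R).
  apply/funext => x; rewrite /patch mem_setE in_itv/= andbT pmulr_rgt0//.
by apply: (measurableT_comp mf0); exact: measurable_funM.
Qed.

Lemma nnm_levy_weight : nnm levy_weight.
Proof.
apply: nnm_EFin; last first.
  move=> x; case: ifPn => // x0.
  by rewrite mulr_ge0 ?mulr_ge0 ?rho_ge0 ?mulr_gt0 ?ltW.
have -> : (fun x : R => if (0 < x)%R then x * (t * rho (t * x)) else 0)%R =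
    (fun x => x * (t * (if (0 < x)%R then rho (t * x)%R else 0%R)))%R.
  by apply/funext => x; case: ifP => // _; rewrite !mulr0.
apply: measurable_funM => //; apply: measurable_funM => //.
exact: measurable_posR_scale.
Qed.

Lemma Jsimp_cons v m ns s : ns != [::] -> Jsimp rho v (m :: ns) s =
  \int[mu]_(u in `[0%R, s]) ((rho (v * u) * u ^+ m)%:E * Jsimp rho v ns (s - u)%R).
Proof. by case: ns. Qed.

(** Substitute x_i = v u_i: the block powers give v^(wt l), the k - 1 differentials give v^(k-1),
    and each rescaled density gives a factor t. The extra v on both sides avoids the exponent k -
    1. *)
Lemma Jsimp_conv_list l (v s : R) : l != [::] -> (0 < v)%R -> (0 < s)%R ->
  (v ^+ (wt l + size l) * t ^+ size l)%:E * Jsimp rho (t * v) (map succn l) s =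
  v%:E * conv_list levy_weight l (v * s)%R.
Proof.
elim: l s => // a l IH s _ v0 s0.
have vs0 : (0 < v * s)%R by rewrite mulr_gt0.
have hE x : (0 < x)%R -> mon a levy_weight x = (x ^+ a.+1 * (t * rho (t * x)))%:E.
  by move=> x0; rewrite /mon /levy_weight x0 -EFinM exprS; congr EFin; ring.
have [->|ln] := eqVneq l [::].
  rewrite [conv_list _ _]/= hE//= -!EFinM; congr EFin.
  have -> : (wt [:: a] + 1 = a.+2)%N by rewrite /wt/= addn0 addn1.
  rewrite exprMn [(t * (v * s))%R]mulrA.
  by move: (rho _) => r; rewrite !exprS; ring.
set c := (v ^+ (wt l + size l) * t ^+ size l)%R.
have c0 : (0 < c)%R by rewrite mulr_gt0// exprn_gt0.
pose g (u : R) : \bar R := mon a levy_weight (v * u)%R *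
  conv_list levy_weight l (v * s - v * u)%R.
have mh := nnm_levy_weight; have lh := left0_levy_weight.
have mg : nnm g.
  apply: nnmM.
    by apply: (nnm_comp (nnm_mon a mh lh)); exact: measurable_funM.
  apply: (nnm_comp (nnm_conv_list mh lh l)).
  by apply: measurable_funB => //; exact: measurable_funM.
(* The ratio of the two integrands: one factor from the first block, c^-1 v from the induction
   hypothesis. *)
pose k := ((v ^+ a.+1 * t)^-1 * (c^-1 * v))%R.
have k0 : (0 <= k)%R by rewrite mulr_ge0 ?mulr_ge0 ?invr_ge0 ?mulr_ge0 ?exprn_ge0 ?ltW.
have gE u : (0 < u < s)%R -> (rho (t * v * u) * u ^+ a.+1)%:E *
    Jsimp rho (t * v) (map succn l) (s - u)%R = k%:E * g u.
  move=> /andP[u0 us]; have su0 : (0 < s - u)%R by rewrite subr_gt0.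
  have := IH (s - u)%R ln v0 su0; rewrite -/c => /(congr1 (fun y => c^-1%:E * y)).
  rewrite muleA -EFinM mulVf ?gt_eqF// mul1e => ->.
  rewrite /g hE ?mulr_gt0// mulrBr !muleA -!EFinM; congr (_%:E * _).
  rewrite /k exprMn [(t * (v * u))%R]mulrA.
  have vn : (v != 0)%R by rewrite gt_eqF.
  have vSn : (v ^+ a.+1 != 0)%R by rewrite expf_neq0.
  have tn : (t != 0)%R by rewrite gt_eqF.
  by field; rewrite gt_eqF// vSn tn.
have g0 u : ~ (0 < u < s)%R -> g u = 0.
  move=> nus; rewrite /g; have [u0|u0] := leP u 0%R.
    by rewrite left0_mon ?mul0e// mulr_ge0_le0// ltW.
  have [su|su] := leP s u.
    by rewrite left0_conv_list ?mule0// subr_le0 ler_pM2l.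
  by exfalso; apply: nus; rewrite u0.
rewrite [map _ _]/= Jsimp_cons; last by case: (l) ln.
have -> : \int[mu]_(u in `[0%R, s]) ((rho (t * v * u) * u ^+ a.+1)%:E *
    Jsimp rho (t * v) (map succn l) (s - u)%R) = k%:E * \int[mu]_u g u.
  (* The endpoints are dropped: at u = 0 the value of [rho] is arbitrary, and the induction
     hypothesis needs s - u > 0. *)
  rewrite integral_itv_bndoo; last first.
    apply: (@eq_measurable_fun _ _ _ _ _ (fun u => k%:E * g u)).
      by move=> u /set_mem/=; rewrite in_itv/= => us; rewrite gE.
    apply: measurable_funTS; apply: emeasurable_funM => //; exact: mg.1.
  rewrite -integral_nnmZ ?lee_fin// [LHS]integral_mkcond.
  apply: eq_integral => u _; rewrite /patch mem_setE in_itv/=.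
  case: ifPn => [/gE -> //|/negP nus].
  by rewrite g0 ?mule0.
have -> : conv_list levy_weight (a :: l) (v * s)%R =
    conv (mon a levy_weight) (conv_list levy_weight l) (v * s)%R.
  by case: (l) ln.
have mi : nnm (fun u : R => mon a levy_weight u * conv_list levy_weight l (v * s - u)%R).
  apply: nnmM; first exact: nnm_mon.
  by apply: (nnm_comp (nnm_conv_list mh lh l)); exact: measurable_funB.
rewrite /conv -(integral_scale v0 mi) -/(g _) !muleA -!EFinM; congr (_%:E * _).
rewrite wt_cons [size (a :: l)]/= /k.
have -> : ((a + wt l).+1 + (size l).+1 = a.+1 + 1 + (wt l + size l))%N by lia.
rewrite [in LHS]exprD [(v ^+ (a.+1 + 1))%R]exprD [(t ^+ _.+1)%R]exprS expr1.
have -> : (v ^+ a.+1 * v * v ^+ (wt l + size l) * (t * t ^+ size l) =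
   v ^+ a.+1 * v * t * c)%R by rewrite /c; ring.
have cn : (c != 0)%R by rewrite gt_eqF.
have vSn : (v ^+ a.+1 != 0)%R by rewrite expf_neq0// gt_eqF.
have tn : (t != 0)%R by rewrite gt_eqF.
by field; rewrite cn vSn tn.
Qed.

End simplex_integral.

(** * The Poisson-Kingman stick-breaking sequence *)

Section stick_breaking.
Context {R : realType}.
Local Notation mu := (@lebesgue_measure R).
Variables (rho f : R -> R) (t : R).
Hypotheses (rho_meas : measurable_fun posR rho)
  (rho_ge0 : forall x : R, (0 < x)%R -> (0 <= rho x)%R)
  (f_pos : forall x : R, (0 < x)%R -> (0 < f x)%R)
  (f_cont : {in posR, continuous f}) (t0 : (0 < t)%R).

Definition rescaled (x : R) : R := (if (0 < x)%R then f (t * x) else 0)%R.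
Local Notation FE := (fun x => (rescaled x)%:E).
Local Notation h := (levy_weight rho t).

Lemma measurable_f : measurable_fun posR f.
Proof.
apply: open_continuous_measurable_fun; last exact: f_cont.
exact: interval_open.
Qed.

Lemma rescaled_pos x : (0 < x)%R -> (0 < rescaled x)%R.
Proof. by move=> x0; rewrite /rescaled x0 f_pos// mulr_gt0. Qed.

Lemma nnm_rescaled : nnm FE.
Proof.
apply: nnm_EFin; first exact: (measurable_posR_scale t0 measurable_f).
by move=> x; rewrite /rescaled; case: ifPn => // x0; rewrite ltW// f_pos// mulr_gt0.
Qed.

Lemma left0_rescaled : left0 FE.
Proof. by move=> x x0; rewrite /rescaled ltNge x0. Qed.

Lemma rescaled_cont : {in posR, continuous rescaled}.
Proof.
move=> x /set_mem/posRP x0.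
have cf : f (t * y)%R @[y --> x] --> f (t * x)%R.
  apply: (@continuous_comp _ _ _ (fun y : R => t * y)%R f).
    exact: mulrl_continuous.
  by apply: f_cont; apply/mem_set/posRP; rewrite mulr_gt0.
rewrite /continuous_at {2}/rescaled x0.
apply: cvg_trans cf; apply: near_eq_cvg; near=> y.
by rewrite /rescaled; suff -> : (0 < y)%R by []; near: y; exact: lt_nbhsr.
Unshelve. all: by end_near. Qed.

Let mh := nnm_levy_weight rho_meas rho_ge0 t0.
Let lh := left0_levy_weight rho t.

(** Each density [ftilde] contributes a ratio F(s (1 - g)) / F(s). These telescope, so only the
    initial 1 / F(s) and the final F remain. *)
Lemma PKiter_word (Bs : seq (set R)) (s : R) : (0 < s)%R ->
  (forall i, measurable (nth setT Bs i)) ->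
  PKiter rho f (size Bs) (nth setT Bs) (t * s)%R =
  ((rescaled s)^-1)%:E * word h (map indicE_fun Bs) FE s.
Proof.
elim: Bs s => [|B Bs IH] s s0 mB.
  by rewrite /= -EFinM mulVf// gt_eqF// rescaled_pos.
have mB0 : measurable B := mB 0%N.
have mBs i : measurable (nth setT Bs i) := mB i.+1.
have r0 : (0 <= (rescaled s)^-1)%R by rewrite invr_ge0 ltW// rescaled_pos.
have mW : nnm (word h (map indicE_fun Bs) FE).
  by apply: nnm_word => //; [exact: nnms_indic | exact: nnm_rescaled].
have mi : nnm (fun g : R => (indicE_fun B g * ((\1_I01R g)%:E * h (g * s)%R)) *
    word h (map indicE_fun Bs) FE (s * (1 - g))%R).
  by apply: nnm_Lop_integrand => //; exact: nnm_indic.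
rewrite /= {1}/Lop -integral_nnmZ ?lee_fin// [LHS]integral_mkcond.
apply: eq_integral => g _; rewrite /patch.
case: ifPn => [/set_mem[/= Bg gI]|/negP nBg]; last first.
  rewrite /indicE_fun !indicE; case Bg : (g \in B); last by rewrite !mul0e mule0.
  case gI : (g \in I01R); last by rewrite !(mul0e, mule0).
  by exfalso; apply: nBg; apply/mem_set; split; apply: set_mem.
have [g0 g1] := I01RP gI.
have sg0 : (0 < s * (1 - g))%R by rewrite mulr_gt0.
have -> : (t * s * (1 - g) = t * (s * (1 - g)))%R by ring.
rewrite -[PKiter _ _ _ _ _]/(PKiter rho f (size Bs) (nth setT Bs) (t * (s * (1 - g)))%R).
rewrite IH// /indicE_fun !indicE !mem_set// !mul1e !muleA.
congr (_ * _); rewrite /levy_weight /ftilde -!EFinM; congr EFin.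
rewrite /rescaled s0 sg0 mulr_gt0//.
have -> : (t * (g * s) = g * (t * s))%R by ring.
have -> : (t * (s * (1 - g)) = (1 - g) * (t * s))%R by ring.
have f1 : (f (t * s) != 0)%R by rewrite gt_eqF// f_pos// mulr_gt0.
have f2 : (f ((1 - g) * (t * s)) != 0)%R by rewrite gt_eqF// f_pos// !mulr_gt0.
by field; rewrite f1 f2.
Qed.

Lemma PKiter_I01R m s : PKiter rho f m (fun=> I01R) s = PKiter rho f m (fun=> setT) s.
Proof.
elim: m s => //= m IH s; rewrite setIid setTI.
by apply: eq_integral => g _; rewrite IH.
Qed.

Context {d : measure_display} {Omega : measurableType d}.
Variables (P : probability Omega R) (G : nat -> Omega -> R).
Hypothesis HG : PK_construction P rho f t G.

Let mG : forall j, measurable_fun setT (G j) := HG.1.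

Lemma prodseq_indic (Bs : seq (set R)) (g : nat -> R) :
  prodseq (map indicE_fun Bs) g =
  (\1_[set x : nat -> R | forall j, (j < size Bs)%N -> nth setT Bs j (x j)] g)%:E.
Proof.
elim: Bs g => [|B Bs IH] g /=.
  by rewrite indicE mem_set.
rewrite IH /indicE_fun -EFinM !indicE -natrM mulnb; congr ((nat_of_bool _)%:R%:E).
apply/andP/idP => [[/set_mem B0 /set_mem BS]|/set_mem H].
  by apply/mem_set; case=> [|j] //= /BS.
by split; apply/mem_set; [exact: (H 0%N) | move=> j jl; exact: (H j.+1)].
Qed.

Lemma expectation_indic (Bs : seq (set R)) : (forall i, measurable (nth setT Bs i)) ->
  FE 1%R * \int[P]_w prodseq (map indicE_fun Bs) (G ^~ w) =
  word h (map indicE_fun Bs) FE 1%R.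
Proof.
move=> mB; pose S := \bigcap_(j in [set j | (j < size Bs)%N])
  [set w | nth setT Bs j (G j w)].
have mS : measurable S.
  apply: bigcap_measurableType => j _.
  by rewrite -[X in measurable X]setTI; exact: mG.
have -> : \int[P]_w prodseq (map indicE_fun Bs) (G ^~ w) = P S.
  rewrite -[X in _ = P X]setIT -integral_indic//; apply: eq_integral => w _.
  by rewrite prodseq_indic !indicE.
have := PKiter_word ltr01 mB; rewrite mulr1 (HG.2 _ _ mB) => ->.
by rewrite muleA -EFinM divff ?mul1e// gt_eqF// rescaled_pos.
Qed.

Lemma expectation_sticks phis : nnms phis ->
  FE 1%R * \int[P]_w prodseq phis (G ^~ w) = word h phis FE 1%R.
Proof. by move=> mphis; apply: expectation_word => //; [exact: nnm_rescaled | exact: expectation_indic]. Qed.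

(* Marginalising over one more stick: this replaces the identity [Lop 1 f = f]. *)
Lemma word_consistency phis : nnms phis ->
  word h phis (Lop h (cst 1) FE) 1%R = word h phis FE 1%R.
Proof.
move=> mphis; rewrite -word_rcons -!expectation_sticks//; last first.
  by apply: nnms_rcons => //; exact: nnm_cst.
congr (_ * _); apply: eq_integral => w _.
by rewrite prodseq_rcons mule1.
Qed.

(** [PKiter] integrates over (0, 1) only, so the cylinder with all factors (0, 1) has the same
    probability as the whole space. *)
Lemma ae_sticks_I01R : {ae P, forall w, forall j, I01R (G j w)}.
Proof.
apply: ae_foralln => j.
have mI : measurable [set w | I01R (G j w)].
  by rewrite -[X in measurable X]setTI; apply: mG => //; exact: measurable_I01R.
exists (~` [set w | I01R (G j w)]); split; [exact: measurableC| |by move=> w].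
have P1 : P [set w | I01R (G j w)] = 1.
  apply/eqP; rewrite eq_le probability_le1//=.
  have := HG.2 j.+1 (fun=> I01R) (fun=> measurable_I01R).
  rewrite PKiter_I01R -(HG.2 j.+1 (fun=> setT) (fun=> measurableT)).
  have -> : \bigcap_(i in [set i | (i < j.+1)%N]) [set w | [set: R] (G i w)] = setT.
    by apply/seteqP; split.
  rewrite probability_setT => <-; apply: le_measure; rewrite ?inE//.
  - apply: mem_set; apply: bigcap_measurableType => i _.
    by rewrite -[X in measurable X]setTI; apply: mG => //; exact: measurable_I01R.
  - exact: mem_set.
  - by move=> w; apply; rewrite /=.
by apply: etrans (probability_setC P mI) _; rewrite P1 subee.
Qed.

(** Here p is the total of the pieces used by the blocks and 1 - p the argument left to F. Of the
    p^(n+k) in [Jsimp_conv_list], one p is cancelled there and one by the factor p t of [I_ftilde],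
    whence n + k - 2; likewise t^k drops to t^(k-1). *)
Lemma What_simplex l : l != [::] ->
  What h FE l 1%R = (f t * t ^+ (size l - 1))%:E *
    \int[mu]_(p in I01R) ((p ^+ (wt l + size l - 2))%:E *
      I_ftilde rho f (map succn l) t p).
Proof.
move=> ln; have k0 : (0 < size l)%N by case: (l) ln.
have n0 : (0 < wt l)%N by case: (l) ln.
have := mon_What mh lh nnm_rescaled left0_rescaled ln => /(congr1 (fun y => y 1%R)).
rewrite /mon expr1n mul1e => ->.
set K := conv_list h l.
pose c := ((f t * t ^+ (size l - 1))^-1)%R.
have ft : (0 < f t)%R by exact: f_pos.
have c0 : (0 <= c)%R by rewrite invr_ge0 mulr_ge0 ?exprn_ge0 ?ltW.
have mi : nnm (fun p : R => K p * FE (1 - p)%R).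
  apply: nnmM; first exact: nnm_conv_list.
  by apply: (nnm_comp nnm_rescaled); exact: measurable_funB.
have -> : \int[mu]_(p in I01R) ((p ^+ (wt l + size l - 2))%:E *
    I_ftilde rho f (map succn l) t p) = c%:E * conv K FE 1%R.
  rewrite /conv -(integral_nnmZ mu _ mi) ?lee_fin// [LHS]integral_mkcond.
  apply: eq_integral => p _; rewrite /patch.
  case: ifPn => [/set_mem pI|/negP npI]; last first.
    have [p0|p0] := leP p 0%R.
      by rewrite /K left0_conv_list// ?mul0e ?mule0.
    have [p1|p1] := leP 1%R p.
      by rewrite left0_rescaled ?subr_le0// !mule0.
    by exfalso; apply: npI; apply/mem_set; rewrite /I01R/= in_itv/= p0.
  have [p0 p1] := I01RP pI.
  have := Jsimp_conv_list rho_meas rho_ge0 t0 ln p0 ltr01.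
  set A := (p ^+ _ * _)%R.
  have A0 : (A != 0)%R by rewrite mulf_neq0 ?expf_neq0 ?gt_eqF.
  move=> /(congr1 (fun y => A^-1%:E * y)).
  rewrite muleA -EFinM mulVf// mul1e mulr1 /I_ftilde => ->.
  rewrite -/K /rescaled p1.
  have -> : (t * (1 - p) = (1 - p) * t)%R by rewrite mulrC.
  move: (K p) (f ((1 - p) * t)%R) => y X.
  have E1 (a1 a2 a3 a4 : R) : a1%:E * (a2%:E * (a3%:E * y) * a4%:E) =
      (a1 * (a2 * a3) * a4)%:E * y.
    by rewrite !EFinM -!muleA [y * _]muleC.
  have E2 (a1 a2 : R) : a1%:E * (y * a2%:E) = (a1 * a2)%:E * y.
    by rewrite EFinM -muleA [y * _]muleC.
  rewrite E1 E2; congr (_%:E * _).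
  rewrite /A /c; have -> : (wt l + size l = (wt l + size l - 2) + 2)%N by lia.
  rewrite addnK.
  have -> : (t ^+ size l = t * t ^+ (size l - 1))%R by rewrite -exprS; congr (_ ^+ _)%R; lia.
  move: (wt l + size l - 2)%N (size l - 1)%N => a b.
  have pa : (p ^+ a != 0)%R by rewrite expf_neq0// gt_eqF.
  have tb : (t ^+ b != 0)%R by rewrite expf_neq0// gt_eqF.
  have pn : (p != 0)%R by rewrite gt_eqF.
  have tn : (t != 0)%R by rewrite gt_eqF.
  have fn : (f t != 0)%R by rewrite gt_eqF.
  rewrite exprD expr2; field.
  by rewrite pa tb pn tn fn.
by rewrite muleA -EFinM /c divff ?mul1e// mulf_neq0 ?expf_neq0// gt_eqF.
Qed.

(** Values outside (0, 1) are sent to 1/2, measurably. The clipped sticks satisfy the pointwise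
    hypotheses everywhere and agree with G almost surely. *)
Definition clip (x : R) : R := (\1_I01R x * x + (1 - \1_I01R x) / 2)%R.

Lemma clip_id x : I01R x -> clip x = x.
Proof.
by move=> xI; rewrite /clip; have [[-> _]|[_ //]] := indic_I01RP x; rewrite subrr mul0r addr0 mul1r.
Qed.

Lemma clip_I01R x : I01R (clip x).
Proof.
rewrite /clip; have [[-> xI]|[-> _]] := indic_I01RP x.
  by rewrite subrr mul0r addr0 mul1r.
by rewrite mul0r add0r subr0 /I01R/= in_itv/=; apply/andP; split; lra.
Qed.

Lemma measurable_clip : measurable_fun setT clip.
Proof.
have m1 : measurable_fun setT (\1_I01R : R -> R).
  by apply: measurable_indic; exact: measurable_I01R.
apply: measurable_funD; first exact: measurable_funM.
by apply: measurable_funM => //; exact: measurable_funB.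
Qed.

Lemma measurable_stick (g : nat -> Omega -> R) j : (forall i, measurable_fun setT (g i)) ->
  measurable_fun setT (fun w => stick (g ^~ w) j).
Proof.
move=> mg; rewrite /stick; apply: measurable_funM => //.
by apply: measurable_prod => i _; exact: measurable_funB.
Qed.

Lemma measurable_label_series n (pi : {set {set 'I_n}}) (g : nat -> Omega -> R) :
  (forall i, measurable_fun setT (g i)) ->
  measurable_fun setT (fun w => \esum_(x in [set x | induces pi x])
    (\prod_(m < n) stick (g ^~ w) (x m))%:E).
Proof.
move=> mg; apply: (@measurable_esum R _ _ {ffun 'I_n -> nat} _
  (fun x w => (\prod_(m < n) stick (g ^~ w) (x m))%:E)) => x.
by apply/measurable_EFinP; apply: measurable_prod => m _; exact: measurable_stick.
Qed.

(** Monotone convergence turns the sampling probability into the limit of the probabilities that all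
    labels are below M, and these are iterates of [occ] from [only_nil]. *)
Lemma sampling_partition_prob_What n (pi : {set {set 'I_n}}) : (0 < n)%N ->
  finset.partition pi [set: 'I_n]%SET ->
  FE 1%R * sampling_partition_prob P (Ptilde G) pi =
  What h FE [seq #|A : {set 'I_n}|.-1 | A <- enum pi] 1%R.
Proof.
move=> n_pos Hpi; set l := [seq _ | _ <- _].
pose Gc j w := clip (G j w).
have mGc j : measurable_fun setT (Gc j).
  by apply: (measurableT_comp measurable_clip); exact: mG.
have GcI w j : I01R (Gc j w) by exact: clip_I01R.
have GGc : {ae P, forall w, G ^~ w = Gc ^~ w}.
  apply: filterS ae_sticks_I01R => w wI; apply/funext => j.
  by rewrite /Gc clip_id.
have stick0 w j : (0 <= stick (Gc ^~ w) j)%R.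
  apply: mulr_ge0; first by have [/ltW] := I01RP (GcI w j).
  by apply: prodr_ge0 => i _; have [_ /ltW] := I01RP (GcI w i).
have mD M : nnm (fun w => (distinct_sum M (stick (Gc ^~ w)) [::] l)%:E).
  have := nnm_occ_mass mGc M l 0%N; congr nnm; apply/funext => w.
  by rewrite -occ_massE.
have ndD w : {homo (fun M => (distinct_sum M (stick (Gc ^~ w)) [::] l)%:E) :
    u v / (u <= v)%N >-> u <= v}.
  apply: homo_leq => // [x y z|M]; first exact: le_trans.
  by rewrite lee_fin le_distinct_sumS.
have F1 : 0 <= FE 1%R by rewrite lee_fin ltW// rescaled_pos.
pose u M := iter M (occ h) (only_nil FE) l 1%R.
have uE M : FE 1%R * \int[P]_w (distinct_sum M (stick (Gc ^~ w)) [::] l)%:E = u M.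
  rewrite -[RHS]/(word h [::] (iter M (occ h) (only_nil FE) l) 1%R).
  rewrite -(expectation_occ_mass mG mh nnm_rescaled expectation_sticks M l (phis := [::]) I).
  congr (_ * _); apply: ae_eq_integral => //.
  - exact: (mD M).1.
  - apply: (nnmM (nnm_cst _) _).1 => //.
    exact: (nnm_occ_mass mG M l 0%N).
  apply: filterS GGc => w Gw _ /=.
  by rewrite mul1e -occ_massE// -Gw.
have ndI : {homo (fun M => \int[P]_w (distinct_sum M (stick (Gc ^~ w)) [::] l)%:E) :
    a b / (a <= b)%N >-> a <= b}.
  by move=> a b ab; apply: le_integral_nnm => // w; exact: ndD.
have -> : sampling_partition_prob P (Ptilde G) pi =
    limn (fun M => \int[P]_w (distinct_sum M (stick (Gc ^~ w)) [::] l)%:E).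
  rewrite -integral_nnm_lim//.
  transitivity (\int[P]_w \esum_(x in [set x : {ffun 'I_n -> nat} | induces pi x])
    (\prod_(m < n) stick (Gc ^~ w) (x m))%:E); last first.
    by apply: eq_integral => w _; exact: esum_labelings.
  apply: ae_eq_integral => //.
  - exact: (measurable_label_series pi mG).
  - exact: (measurable_label_series pi mGc).
  by apply: filterS GGc => w Gw _; rewrite -Gw.
rewrite -limn_nnmZ//; last by move=> M; exact: integral_nnm_ge0.
under eq_fun do rewrite uE.
have ndu : {homo u : a b / (a <= b)%N >-> a <= b}.
  by move=> a b ab; rewrite -!uE lee_wpmul2l// ndI.
have cu : cvgn u by exact: ereal_nondecreasing_is_cvgn.
(* The nondecreasing sequence u stays below W_l(1) and comes within any e > 0 of it. *)
apply/eqP; rewrite eq_le; apply/andP; split.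
  apply: lime_le => //; apply: nearW => M.
  exact: (iter_occ_only_nil_le mh lh nnm_rescaled left0_rescaled word_consistency).
apply/lee_addgt0Pr => e e0.
have [M hM] := What_le_iter_occ_only_nil mh lh nnm_rescaled left0_rescaled
  rescaled_pos rescaled_cont word_consistency l e0.
apply: (le_trans hM); rewrite leeD2r//.
rewrite (cvg_lim _ (ereal_nondecreasing_cvgn ndu))//.
by apply: ereal_sup_ubound; exists M.
Qed.

End stick_breaking.

Unset Implicit Arguments.

Theorem theorem3p4 (R : realType) (rho f : R -> R)
  (rho_meas : measurable_fun posR rho)
  (rho_ge0 : forall x : R, (0 < x)%R -> (0 <= rho x)%R)
  (rho_int0 : \int[@lebesgue_measure R]_(x in Ioc01R) (x * rho x)%:E < +oo)
  (rho_int1 : \int[@lebesgue_measure R]_(x in gt1R) (rho x)%:E < +oo)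
  (f_law : exists (d0 : measure_display) (Omega0 : measurableType d0)
             (P0 : probability Omega0 R) (J : nat -> Omega0 -> R),
             ranked_PPP P0 rho J /\ has_density P0 (sumJ J) f)
  (f_pos : forall x : R, (0 < x)%R -> (0 < f x)%R)
  (f_cont : {in posR, continuous f})
  (t : R) (t_pos : (0 < t)%R)
  (d : measure_display) (Omega : measurableType d) (P : probability Omega R)
  (G : nat -> Omega -> R) (HG : PK_construction P rho f t G)
  (n : nat) (n_pos : (0 < n)%N) (pi : {set {set 'I_n}})
  (Hpi : finset.partition pi [set: 'I_n]%SET) :
  sampling_partition_prob P (Ptilde G) pi =
  (t ^+ (#|pi| - 1))%:E *
  \int[@lebesgue_measure R]_(p in I01R)
     ((p ^+ (n + #|pi| - 2))%:E * I_ftilde rho f (map (fun A : {set 'I_n} => #|A|) (enum pi)) t p).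
Proof.
pose l := [seq #|A : {set 'I_n}|.-1 | A <- enum pi].
have cardK A : A \in enum pi -> #|A|.-1.+1 = #|A|.
  rewrite mem_enum => Api; rewrite prednK// card_gt0; apply/eqP => A0.
  by move: Api; rewrite A0; case/and3P: Hpi => _ _ /negP.
have lE : [seq #|A : {set 'I_n}| | A <- enum pi] = map succn l.
  by rewrite -map_comp; apply/esym/eq_in_map => A Api; exact: cardK.
have szl : size l = #|pi| by rewrite size_map -cardE.
have wtl : wt l = n.
  rewrite /wt -lE sumnE big_map big_enum -(card_partition Hpi).
  by rewrite cardsT card_ord.
have ln : l != [::].
  by apply/eqP => l0; move: wtl n_pos; rewrite l0 => <-.
have := sampling_partition_prob_What rho_meas rho_ge0 f_pos f_cont t_pos HG n_pos Hpi.
rewrite -/l (What_simplex rho_meas rho_ge0 f_pos f_cont t_pos ln) wtl szl -lE.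
(* [rescaled] at 1 is f(t), the normalisation on both sides; it is then divided out. *)
rewrite /rescaled ltr01 mulr1 EFinM -muleA.
have ft : (f t != 0)%R by rewrite gt_eqF// f_pos.
move=> /(congr1 (fun z => (f t)^-1%:E * z)) /=.
rewrite [X in X = _ -> _]muleA [X in _ = X -> _]muleA -EFinM mulVf//.
by rewrite !mul1e.
Qed.
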